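(* Let $k$ be a field of characteristic $0$, $X$ a smooth scheme over $k$, and $\mathcal{A}$ a commutative $\mathcal{D}_X$-algebra. Given a CY$_{\mathcal{A}}$-structure, let $\nabla^r:\mathcal{T}_{\mathcal{A}}\to\mathcal{A}$ be the associated map $\nabla^r(a\tau)=a\cdot\tau$ ($a\in\mathcal{A}$, $\tau\in\mathcal{T}_X$). Then there exists a unique differential of degree $1$ on the Gerstenhaber algebra $\Lambda^\bullet\mathcal{T}_{\mathcal{A}}$ whose component $\mathcal{T}_{\mathcal{A}}\to\mathcal{A}$ coincides with $\nabla^r$ and which makes $\Lambda^\bullet\mathcal{T}_{\mathcal{A}}$ a Batalin-Vilkovisky algebra.
   Context: A Gerstenhaber algebra is a $\mathbb{Z}$-graded (graded-)commutative algebra $G^\bullet$ with a bracket $[\,,]$ of degree $1$ making $G^\bullet[-1]$ (where $(G[-1])^j=G^{j-1}$) a graded Lie algebra, so in particular $[a,b]=-(-1)^{(|a|-1)(|b|-1)}[b,a]$, and such that $[a,b c]=[a,b] c+(-1)^{(|a|-1)|b|}b[a,c]$ for homogeneous $a,b,c$. A Batalin-Vilkovisky (BV) algebra is a Gerstenhaber algebra $B^\bullet$ with a differential $d$ of degree $1$ ($d^2=0$, $k$-linear) such that $(-1)^{|a|}[a,b]=d(ab)-da\cdot b-(-1)^{|a|}a\cdot db$ for all homogeneous $a,b$. A commutative $\mathcal{D}_X$-algebra is a commutative, associative, unital algebra $\mathcal{A}$ in the tensor category of left $\mathcal{D}_X$-modules quasicoherent over $\mathcal{O}_X$ (tensor product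 over $\mathcal{O}_X$, vector fields acting by the Leibniz rule); thus $\mathcal{T}_X$ acts on $\mathcal{A}$ by derivations, written $\tau(a)$. Put $\mathcal{T}_{\mathcal{A}}=\mathcal{A}\otimes_{\mathcal{O}_X}\mathcal{T}_X$, writing $a\tau$ for $a\otimes\tau$, with Lie bracket $[a\tau,b\tau']=a\tau(b)\tau'-b\tau'(a)\tau+ab[\tau,\tau']$ and with the $\mathcal{A}$-linear action on $\mathcal{A}$ by derivations $(a\tau)(b)=a\,\tau(b)$. $\Lambda^\bullet\mathcal{T}_{\mathcal{A}}$ is the exterior algebra over $\mathcal{A}$, with $\mathcal{A}$ in degree $0$ and $\mathcal{T}_{\mathcal{A}}$ in degree $-1$. It is a Gerstenhaber algebra with the unique bracket of degree $1$ such that $[\tau,a]=\tau(a)$ for $a\in\mathcal{A},\tau\in\mathcal{T}_{\mathcal{A}}$ and which on $\mathcal{T}_{\mathcal{A}}$ is the Lie bracket $[a\tau,b\tau']=a\tau(b)\tau'-b\tau'(a)\tau+ab[\tau,\tau']$ ($a,b\in\mathcal{A}$, $\tau,\tau'\in\mathcal{T}_X$). $\mathcal{D}_{\mathcal{A}}$ is the sheaf of associative algebras generated by the algebra $\mathcal{A}$ and the left $\mathcal{O}_X$-module $\mathcal{T}_X$ (so $f\cdot\tau=f\tau$ for $f\in\mathcal{O}_X$), subject to $\tau\cdot a-a\cdot\tau=\tau(a)$ and $\tau\cdot\tau'-\tau'\cdot\tau=[\tau,\tau']$ for $a\in\mathcal{A}$, $\tau,\tau'\in\mathcal{T}_X$;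 as a left $\mathcal{A}$-module $\mathcal{D}_{\mathcal{A}}=\mathcal{A}\otimes_{\mathcal{O}_X}\mathcal{D}_X$. A CY$_{\mathcal{A}}$-structure is a right $\mathcal{D}_{\mathcal{A}}$-module structure on $\mathcal{A}$ which induces the obvious $\mathcal{A}$-module structure on $\mathcal{A}$; $a\cdot\tau$ denotes the resulting right action of $\tau\in\mathcal{T}_X$ on $a\in\mathcal{A}$. The associated map satisfies $\nabla^r(a\nu)=a\nabla^r(\nu)-\nu(a)$ for $a\in\mathcal{A}$, $\nu\in\mathcal{T}_{\mathcal{A}}$. *)

(* Defs.v *)
From HB Require Import structures.
From mathcomp Require Import all_boot all_order all_algebra.
From mathcomp Require Import all_classical topology.

Set Implicit Arguments.
Unset Strict Implicit.
Unset Printing Implicit Defensive.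
Import GRing.Theory.
Local Open Scope classical_set_scope.
Local Open Scope ring_scope.

Record opens (X : topologicalType) := Opens {
  oset :> set X;
  oset_open : open oset }.

Definition full_open (X : topologicalType) : opens X := Opens (@openT X).

Lemma sub_full (X : topologicalType) (U : opens X) : U `<=` full_open X.
Proof. by []. Qed.

(* The condition is stated for families agreeing on every open set contained
   in an overlap, which is the same as agreeing on the overlap itself. The
   empty family is allowed: F(empty) is a singleton, whence the rings below
   may be zero (comPzRingType rather than comNzRingType). *)
Definition sheaf_axiom (X : topologicalType) (F : opens X -> Type)
    (r : forall U V : opens X, V `<=` U -> F U -> F V) : Prop :=
  forall (I : Type) (V : I -> opens X) (U : opens X)
    (hV : forall i, V i `<=` U) (s : forall i, F (V i)),
  (forall x, oset U x -> exists i, oset (V i) x) ->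
  (forall i j (W : opens X) (hi : W `<=` V i) (hj : W `<=` V j),
     r _ _ hi (s i) = r _ _ hj (s j)) ->
  exists! t : F U, forall i, r _ _ (hV i) t = s i.

Record abSheaf (X : topologicalType) := AbSheaf {
  asec :> opens X -> zmodType;
  ares : forall U V : opens X, V `<=` U -> {additive asec U -> asec V};
  ares_id : forall (U : opens X) (h : U `<=` U) s, ares h s = s;
  ares_comp : forall (U V W : opens X) (hVU : V `<=` U) (hWV : W `<=` V)
    (hWU : W `<=` U) s, ares hWV (ares hVU s) = ares hWU s;
  asec_sheaf : @sheaf_axiom X asec (fun U V h => ares h) }.
Arguments ares {X _ U V} _.

Record ringSheaf (X : topologicalType) := RingSheaf {
  rsec :> opens X -> pzRingType;
  rres : forall U V : opens X, V `<=` U -> {rmorphism rsec U -> rsec V};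
  rres_id : forall (U : opens X) (h : U `<=` U) s, rres h s = s;
  rres_comp : forall (U V W : opens X) (hVU : V `<=` U) (hWV : W `<=` V)
    (hWU : W `<=` U) s, rres hWV (rres hVU s) = rres hWU s;
  rsec_sheaf : @sheaf_axiom X rsec (fun U V h => rres h) }.
Arguments rres {X _ U V} _.

Record comRingSheaf (X : topologicalType) := ComRingSheaf {
  csec :> opens X -> comPzRingType;
  cres : forall U V : opens X, V `<=` U -> {rmorphism csec U -> csec V};
  cres_id : forall (U : opens X) (h : U `<=` U) s, cres h s = s;
  cres_comp : forall (U V W : opens X) (hVU : V `<=` U) (hWV : W `<=` V)
    (hWU : W `<=` U) s, cres hWV (cres hVU s) = cres hWU s;
  csec_sheaf : @sheaf_axiom X csec (fun U V h => cres h) }.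
Arguments cres {X _ U V} _.

Record modSheaf (X : topologicalType) (R : comRingSheaf X) := ModSheaf {
  msec :> forall U : opens X, lmodType (R U);
  mres : forall U V : opens X, V `<=` U -> {additive msec U -> msec V};
  mres_scale : forall (U V : opens X) (h : V `<=` U) (a : R U) (s : msec U),
    mres h (a *: s) = cres h a *: mres h s;
  mres_id : forall (U : opens X) (h : U `<=` U) s, mres h s = s;
  mres_comp : forall (U V W : opens X) (hVU : V `<=` U) (hWV : W `<=` V)
    (hWU : W `<=` U) s, mres hWV (mres hVU s) = mres hWU s;
  msec_sheaf : @sheaf_axiom X msec (fun U V h => mres h) }.
Arguments mres {X R _ U V} _.

Definition prime_ideal (R : comPzRingType) (P : set R) : Prop :=
  [/\ P 0, forall a b, P a -> P b -> P (a + b), forall a b, P b -> P (a * b),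
      ~ P 1 & forall a b, P (a * b) -> P a \/ P b].

(* {x in U | f is invertible near x}; on a locally ringed space this is the
   nonvanishing locus of f, and f restricts to a unit on it. *)
Definition basic_set (X : topologicalType) (O : comRingSheaf X) (U : opens X)
    (f : O U) : set X :=
  \bigcup_(V in [set V : opens X |
      exists (h : V `<=` U) (g : O V), cres h f * g = 1]) V.

Lemma basic_set_open (X : topologicalType) (O : comRingSheaf X) (U : opens X)
  (f : O U) : open (basic_set f).
Proof. by apply: bigcup_open => V _; exact: oset_open. Qed.

Definition basic_open (X : topologicalType) (O : comRingSheaf X) (U : opens X)
  (f : O U) : opens X := Opens (basic_set_open f).

Lemma basic_open_sub (X : topologicalType) (O : comRingSheaf X) (U : opens X)
  (f : O U) : basic_open f `<=` U.
Proof. by move=> x [V [h _] Vx]; exact: h. Qed.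

(* A(U) -> A(D(f)) is the localization at f of the O(U)-module A(U), for a
   sheaf A of O-algebras with structure morphism alpha. That f acts invertibly
   on A(D(f)) is automatic. *)
Definition localized_at (X : topologicalType) (O A : comRingSheaf X)
    (alpha : forall U, {rmorphism O U -> A U}) (U : opens X) (f : O U) : Prop :=
  (forall a : A U, cres (basic_open_sub (f := f)) a = 0 ->
     exists n : nat, alpha U f ^+ n * a = 0) /\
  (forall b : A (basic_open f), exists (n : nat) (a : A U),
     cres (basic_open_sub (f := f)) (alpha U f) ^+ n * b
     = cres (basic_open_sub (f := f)) a).

(* (U, O|_U) is Spec O(U): x |-> p_x = {f | f is not invertible near x} is a
   bijection from U onto the prime ideals of O(U); under it D(f) corresponds
   to {p | f notin p}, so it is a homeomorphism iff the D(f) form a base of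
   the topology of U; and O(D(f)) = O(U)_f, which determines the sheaf. *)
Definition affine_open (X : topologicalType) (O : comRingSheaf X)
    (U : opens X) : Prop :=
  let p (x : X) : set (O U) := [set f | ~ basic_set f x] in
  [/\ forall x, oset U x -> prime_ideal (p x),
      forall x y, oset U x -> oset U y -> p x = p y -> x = y,
      forall P : set (O U), prime_ideal P -> exists2 x, oset U x & p x = P,
      forall (W : opens X) x, W `<=` U -> oset W x ->
        exists2 f : O U, basic_set f x & basic_open f `<=` W &
      forall f : O U, localized_at (fun V => idfun) f].

(* A morphism X -> Spec k is a ring morphism k -> O_X(X). *)
Record scheme (k : fieldType) := Scheme {
  space :> topologicalType;
  struct_sheaf : comRingSheaf space;
  scheme_affine : forall x : space,
    exists2 U : opens space, oset U x & affine_open struct_sheaf U;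
  struct_map : {rmorphism k -> struct_sheaf (full_open space)} }.

Notation "'\O_' X" := (struct_sheaf X) (at level 8, X at level 2, format "'\O_' X").

Definition kcst (k : fieldType) (X : scheme k) (U : opens X) :
    {rmorphism k -> \O_X U} :=
  cres (@sub_full X U) \o @struct_map k X.

Definition finite_type (k : fieldType) (X : scheme k) (U : opens X) : Prop :=
  exists (n : nat) (g : 'I_n -> \O_X U), forall S : set (\O_X U),
    (forall c, S (kcst U c)) -> (forall i, S (g i)) ->
    (forall a b, S a -> S b -> S (a + b)) ->
    (forall a b, S a -> S b -> S (a * b)) -> forall a, S a.

Definition formally_smooth (k : fieldType) (X : scheme k) (U : opens X) : Prop :=
  forall (B C : comPzRingType) (kB : {rmorphism k -> B})
    (pi : {rmorphism B -> C}) (f : {rmorphism \O_X U -> C}),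
  (forall c, exists b, pi b = c) ->
  (forall x y, pi x = 0 -> pi y = 0 -> x * y = 0) ->
  (forall c, f (kcst U c) = pi (kB c)) ->
  exists g : {rmorphism \O_X U -> B},
    (forall c, g (kcst U c) = kB c) /\ (forall a, pi (g a) = f a).

(* Smooth = locally of finite presentation and formally smooth; over a field
   finite type and finite presentation coincide. *)
Definition smooth (k : fieldType) (X : scheme k) : Prop :=
  forall x : X, exists2 U : opens X, oset U x &
    [/\ affine_open \O_X U, finite_type U & formally_smooth U].

(* Sections over U of the sheaf End_k(O_X). *)
Record endo (k : fieldType) (X : scheme k) (U : opens X) := Endo {
  efun : forall V : opens X, V `<=` U -> \O_X V -> \O_X V;
  efunD : forall (V : opens X) (h : V `<=` U) f g, efun h (f + g) = efun h f + efun h g;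
  efunk : forall (V : opens X) (h : V `<=` U) c f, efun h (kcst V c * f) = kcst V c * efun h f;
  efun_res : forall (V W : opens X) (hV : V `<=` U) (hW : W `<=` U)
    (hWV : W `<=` V) f, efun hW (cres hWV f) = cres hWV (efun hV f) }.

Lemma endo_eq (k : fieldType) (X : scheme k) (U : opens X) (P Q : endo U) :
  (forall (V : opens X) (h : V `<=` U) f, efun P h f = efun Q h f) -> P = Q.
Proof.
case: P Q => [p p1 p2 p3] [q q1 q2 q3] /= pq.
have e : p = q by do 3![apply/functional_extensionality_dep => ?]; exact: pq.
move: p1 p2 p3; rewrite e => p1 p2 p3.
by congr Endo; exact: Prop_irrelevance.
Qed.

HB.instance Definition _ (k : fieldType) (X : scheme k) (U : opens X) :=
  gen_eqMixin (endo U).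
HB.instance Definition _ (k : fieldType) (X : scheme k) (U : opens X) :=
  gen_choiceMixin (endo U).

Lemma kcst_res (k : fieldType) (X : scheme k) (U V : opens X) (h : V `<=` U) c :
  cres h (kcst U c) = kcst V c.
Proof. exact: cres_comp. Qed.

Definition endo_zero (k : fieldType) (X : scheme k) (U : opens X) : endo U.
Proof.
exists (fun V h f => 0).
- by move=> *; rewrite addr0.
- by move=> *; rewrite mulr0.
- by move=> *; rewrite rmorph0.
Defined.

Definition endo_opp (k : fieldType) (X : scheme k) (U : opens X) (P : endo U) :
  endo U.
Proof.
exists (fun V h f => - efun P h f).
- by move=> *; rewrite efunD opprD.
- by move=> *; rewrite efunk mulrN.
- by move=> V W hV hW hWV f; rewrite (efun_res P hV hW) rmorphN.
Defined.

Definition endo_add (k : fieldType) (X : scheme k) (U : opens X)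
  (P Q : endo U) : endo U.
Proof.
exists (fun V h f => efun P h f + efun Q h f).
- by move=> *; rewrite !efunD addrACA.
- by move=> *; rewrite !efunk mulrDr.
- by move=> V W hV hW hWV f; rewrite (efun_res P hV hW) (efun_res Q hV hW) rmorphD.
Defined.

Definition endo_one (k : fieldType) (X : scheme k) (U : opens X) : endo U.
Proof. by exists (fun V h f => f). Defined.

Definition endo_mul (k : fieldType) (X : scheme k) (U : opens X)
  (P Q : endo U) : endo U.
Proof.
exists (fun V h f => efun P h (efun Q h f)).
- by move=> *; rewrite !efunD.
- by move=> *; rewrite !efunk.
- by move=> V W hV hW hWV f; rewrite (efun_res Q hV hW) (efun_res P hV hW).
Defined.

Fact endo_addA (k : fieldType) (X : scheme k) (U : opens X) :
  associative (@endo_add k X U).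
Proof. by move=> P Q R; apply: endo_eq => V h f /=; rewrite addrA. Qed.
Fact endo_addC (k : fieldType) (X : scheme k) (U : opens X) :
  commutative (@endo_add k X U).
Proof. by move=> P Q; apply: endo_eq => V h f /=; rewrite addrC. Qed.
Fact endo_add0 (k : fieldType) (X : scheme k) (U : opens X) :
  left_id (@endo_zero k X U) (@endo_add k X U).
Proof. by move=> P; apply: endo_eq => V h f /=; rewrite add0r. Qed.
Fact endo_addN (k : fieldType) (X : scheme k) (U : opens X) :
  left_inverse (@endo_zero k X U) (@endo_opp k X U) (@endo_add k X U).
Proof. by move=> P; apply: endo_eq => V h f /=; rewrite addNr. Qed.

HB.instance Definition _ (k : fieldType) (X : scheme k) (U : opens X) :=
  GRing.isZmodule.Build (endo U) (@endo_addA k X U) (@endo_addC k X U)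
    (@endo_add0 k X U) (@endo_addN k X U).

Fact endo_mulA (k : fieldType) (X : scheme k) (U : opens X) :
  associative (@endo_mul k X U).
Proof. by move=> P Q R; apply: endo_eq. Qed.
Fact endo_mul1 (k : fieldType) (X : scheme k) (U : opens X) :
  left_id (@endo_one k X U) (@endo_mul k X U).
Proof. by move=> P; apply: endo_eq. Qed.
Fact endo_mul1r (k : fieldType) (X : scheme k) (U : opens X) :
  right_id (@endo_one k X U) (@endo_mul k X U).
Proof. by move=> P; apply: endo_eq. Qed.
Fact endo_mulDl (k : fieldType) (X : scheme k) (U : opens X) :
  left_distributive (@endo_mul k X U) +%R.
Proof. by move=> P Q R; apply: endo_eq. Qed.
Fact endo_mulDr (k : fieldType) (X : scheme k) (U : opens X) :
  right_distributive (@endo_mul k X U) +%R.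
Proof. by move=> P Q R; apply: endo_eq => V h f /=; rewrite efunD. Qed.

HB.instance Definition _ (k : fieldType) (X : scheme k) (U : opens X) :=
  GRing.Zmodule_isPzRing.Build (endo U) (@endo_mulA k X U) (@endo_mul1 k X U)
    (@endo_mul1r k X U) (@endo_mulDl k X U) (@endo_mulDr k X U).

Definition endo_res (k : fieldType) (X : scheme k) (U V : opens X)
  (h : V `<=` U) (P : endo U) : endo V.
Proof.
exists (fun W hW f => efun P (subset_trans hW h) f).
- by move=> *; rewrite efunD.
- by move=> *; rewrite efunk.
- by move=> *; exact: efun_res.
Defined.

Definition mul_op (k : fieldType) (X : scheme k) (U : opens X) (f : \O_X U) :
  endo U.
Proof.
exists (fun V h g => cres h f * g).
- by move=> *; rewrite mulrDr.
- by move=> *; rewrite mulrCA.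
- by move=> V W hV hW hWV g; rewrite rmorphM (cres_comp hV hWV hW).
Defined.

Definition eval (k : fieldType) (X : scheme k) (U : opens X) (P : endo U)
  (f : \O_X U) : \O_X U := efun P (@subset_refl _ U) f.

(* Grothendieck's differential operators: the operators of order < 0 vanish,
   and P has order < n + 1 iff all [P, f] have order < n. A section of D_X is
   locally of finite order. *)
Fixpoint order_lt (k : fieldType) (X : scheme k) (n : nat) (U : opens X)
    (P : endo U) : Prop :=
  if n is m.+1 then
    forall (V : opens X) (h : V `<=` U) (f : \O_X V),
      order_lt m (endo_res h P * mul_op f - mul_op f * endo_res h P)
  else P = 0.

Definition diffop (k : fieldType) (X : scheme k) (U : opens X) (P : endo U) :
    Prop :=
  forall x, oset U x -> exists (V : opens X) (h : V `<=` U) (n : nat),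
    oset V x /\ order_lt n (endo_res h P).

(* Sections of the tangent sheaf T_X = Der_k(O_X). *)
Record vfield (k : fieldType) (X : scheme k) (U : opens X) := VField {
  vop :> endo U;
  vop_leibniz : forall (V : opens X) (h : V `<=` U) f g,
    efun vop h (f * g) = efun vop h f * g + f * efun vop h g }.

Lemma vop_inj (k : fieldType) (X : scheme k) (U : opens X) :
  injective (@vop k X U).
Proof.
move=> [P p] [Q q] /= e; move: p; rewrite e => p.
by congr VField; exact: Prop_irrelevance.
Qed.

HB.instance Definition _ (k : fieldType) (X : scheme k) (U : opens X) :=
  gen_eqMixin (vfield U).
HB.instance Definition _ (k : fieldType) (X : scheme k) (U : opens X) :=
  gen_choiceMixin (vfield U).

Definition vf_zero (k : fieldType) (X : scheme k) (U : opens X) : vfield U.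
Proof. by exists 0 => V h f g /=; rewrite mul0r mulr0 addr0. Defined.

Definition vf_opp (k : fieldType) (X : scheme k) (U : opens X)
  (t : vfield U) : vfield U.
Proof.
by exists (- (t : endo U)) => V h f g /=; rewrite vop_leibniz opprD mulNr mulrN.
Defined.

Definition vf_add (k : fieldType) (X : scheme k) (U : opens X)
  (t u : vfield U) : vfield U.
Proof.
exists ((t : endo U) + (u : endo U)) => V h f g /=.
by rewrite !vop_leibniz addrACA -mulrDl -mulrDr.
Defined.

Definition vf_scale (k : fieldType) (X : scheme k) (U : opens X) (a : \O_X U)
  (t : vfield U) : vfield U.
Proof.
exists (mul_op a * (t : endo U)) => V h f g /=.
by rewrite vop_leibniz mulrDr mulrA [cres h a * (f * _)]mulrCA.
Defined.

Definition vf_bracket (k : fieldType) (X : scheme k) (U : opens X)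
  (t u : vfield U) : vfield U.
Proof.
exists ((t : endo U) * (u : endo U) - (u : endo U) * (t : endo U)) => V h f g /=.
rewrite /= !(vop_leibniz, efunD) mulrBl mulrBr [X in _ - X]addrACA opprD addrACA.
by congr (_ + _); rewrite opprD addrACA subrr (addr0, add0r).
Defined.

Fact vf_addA (k : fieldType) (X : scheme k) (U : opens X) :
  associative (@vf_add k X U).
Proof. by move=> t u v; apply: vop_inj => /=; rewrite addrA. Qed.
Fact vf_addC (k : fieldType) (X : scheme k) (U : opens X) :
  commutative (@vf_add k X U).
Proof. by move=> t u; apply: vop_inj => /=; rewrite addrC. Qed.
Fact vf_add0 (k : fieldType) (X : scheme k) (U : opens X) :
  left_id (@vf_zero k X U) (@vf_add k X U).
Proof. by move=> t; apply: vop_inj => /=; rewrite add0r. Qed.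
Fact vf_addN (k : fieldType) (X : scheme k) (U : opens X) :
  left_inverse (@vf_zero k X U) (@vf_opp k X U) (@vf_add k X U).
Proof. by move=> t; apply: vop_inj => /=; rewrite addNr. Qed.

HB.instance Definition _ (k : fieldType) (X : scheme k) (U : opens X) :=
  GRing.isZmodule.Build (vfield U) (@vf_addA k X U) (@vf_addC k X U)
    (@vf_add0 k X U) (@vf_addN k X U).

Fact vf_scaleA (k : fieldType) (X : scheme k) (U : opens X) (a b : \O_X U)
  (t : vfield U) : vf_scale a (vf_scale b t) = vf_scale (a * b) t.
Proof.
by apply/vop_inj/endo_eq => V h f /=; rewrite rmorphM mulrA.
Qed.
Fact vf_scale1 (k : fieldType) (X : scheme k) (U : opens X) :
  left_id (1 : \O_X U) (@vf_scale k X U).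
Proof. by move=> t; apply/vop_inj/endo_eq => V h f /=; rewrite rmorph1 mul1r. Qed.
Fact vf_scaleDr (k : fieldType) (X : scheme k) (U : opens X) :
  right_distributive (@vf_scale k X U) +%R.
Proof. by move=> a t u; apply/vop_inj/endo_eq => V h f /=; rewrite mulrDr. Qed.
Fact vf_scaleDl (k : fieldType) (X : scheme k) (U : opens X) (t : vfield U) :
  {morph (@vf_scale k X U)^~ t : a b / a + b}.
Proof.
by move=> a b; apply/vop_inj/endo_eq => V h f /=; rewrite rmorphD mulrDl.
Qed.

HB.instance Definition _ (k : fieldType) (X : scheme k) (U : opens X) :=
  GRing.Zmodule_isLmodule.Build (\O_X U) (vfield U) (@vf_scaleA k X U)
    (@vf_scale1 k X U) (@vf_scaleDr k X U) (@vf_scaleDl k X U).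

Definition vf_res (k : fieldType) (X : scheme k) (U V : opens X)
  (h : V `<=` U) (t : vfield U) : vfield V.
Proof. by exists (endo_res h t) => W hW f g; exact: vop_leibniz. Defined.

(* [dact U P a] is the action on a in A(U) of a differential operator P in
   D_X(U); its values on endomorphisms that are not differential operators are
   irrelevant. The left D_X-module underlying A is quasi-coherent over O_X, and
   unit and multiplication are morphisms of left D_X-modules, where vector
   fields act on the tensor square over O_X by the Leibniz rule. *)
Record DX_algebra (k : fieldType) (X : scheme k) := DXAlgebra {
  alg :> comRingSheaf X;
  alg_unit : forall U : opens X, {rmorphism \O_X U -> alg U};
  alg_unit_res : forall (U V : opens X) (h : V `<=` U) f,
    alg_unit V (cres h f) = cres h (alg_unit U f);
  alg_qcoh : forall x : X, exists2 U : opens X, oset U x &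
    affine_open \O_X U /\ forall f : \O_X U, localized_at alg_unit f;
  dact : forall U : opens X, endo U -> alg U -> alg U;
  dactDl : forall (U : opens X) (P Q : endo U) a, diffop P -> diffop Q ->
    dact (P + Q) a = dact P a + dact Q a;
  dactDr : forall (U : opens X) (P : endo U) a b, diffop P ->
    dact P (a + b) = dact P a + dact P b;
  dact1 : forall (U : opens X) (a : alg U), dact 1 a = a;
  dactM : forall (U : opens X) (P Q : endo U) a, diffop P -> diffop Q ->
    dact (P * Q) a = dact P (dact Q a);
  dact_res : forall (U V : opens X) (h : V `<=` U) (P : endo U) a, diffop P ->
    dact (endo_res h P) (cres h a) = cres h (dact P a);
  dact_O : forall (U : opens X) (f : \O_X U) (a : alg U),
    dact (mul_op f) a = alg_unit U f * a;
  dact_unit : forall (U : opens X) (P : endo U) (f : \O_X U), diffop P ->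
    dact P (alg_unit U f) = alg_unit U (eval P f);
  dact_leibniz : forall (U : opens X) (t : vfield U) (a b : alg U),
    dact t (a * b) = dact t a * b + a * dact t b }.

(* O_X-balanced biadditive maps A x T_X -> N. *)
Record balanced (k : fieldType) (X : scheme k) (A : DX_algebra X)
    (N : opens X -> zmodType)
    (nres : forall U V : opens X, V `<=` U -> N U -> N V)
    (b : forall U : opens X, A U -> vfield U -> N U) : Prop := Balanced {
  balDl : forall (U : opens X) (a a' : A U) (t : vfield U),
    b U (a + a') t = b U a t + b U a' t;
  balDr : forall (U : opens X) (a : A U) (t t' : vfield U),
    b U a (t + t') = b U a t + b U a t';
  balO : forall (U : opens X) (f : \O_X U) (a : A U) (t : vfield U),
    b U (a * alg_unit A U f) t = b U a (f *: t);
  bal_res : forall (U V : opens X) (h : V `<=` U) (a : A U) (t : vfield U),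
    b V (cres h a) (vf_res h t) = nres U V h (b U a t) }.

(* T_A is the tensor product of sheaves, given by its universal property.
   The anchor [anchor U nu a] is the action nu(a) of T_A on A; it and the Lie
   bracket are determined by their values on the local generators a (x) tau. *)
Record tangent_algebroid (k : fieldType) (X : scheme k) (A : DX_algebra X) :=
    TangentAlgebroid {
  TA :> modSheaf A;
  tens : forall U : opens X, A U -> vfield U -> TA U;
  tens_balanced : balanced (fun U V h => mres h) tens;
  tens_scale : forall (U : opens X) (a b : A U) (t : vfield U),
    a *: tens b t = tens (a * b) t;
  tens_univ : forall (N : abSheaf X) (b : forall U, A U -> vfield U -> N U),
    balanced (fun U V h => ares h) b ->
    exists phi : forall U : opens X, {additive TA U -> N U},
      [/\ forall (U V : opens X) (h : V `<=` U) (x : TA U),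
            phi V (mres h x) = ares h (phi U x),
          forall (U : opens X) (a : A U) (t : vfield U),
            phi U (tens a t) = b U a t &
          forall psi : forall U : opens X, {additive TA U -> N U},
            (forall (U V : opens X) (h : V `<=` U) (x : TA U),
               psi V (mres h x) = ares h (psi U x)) ->
            (forall (U : opens X) (a : A U) (t : vfield U),
               psi U (tens a t) = b U a t) ->
            forall (U : opens X) (x : TA U), psi U x = phi U x];
  anchor : forall U : opens X, TA U -> A U -> A U;
  anchorD : forall (U : opens X) (x y : TA U) (a : A U),
    anchor (x + y) a = anchor x a + anchor y a;
  anchor_res : forall (U V : opens X) (h : V `<=` U) (x : TA U) (a : A U),
    anchor (mres h x) (cres h a) = cres h (anchor x a);
  anchor_tens : forall (U : opens X) (a b : A U) (t : vfield U),
    anchor (tens a t) b = a * dact t b;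
  lie : forall U : opens X, TA U -> TA U -> TA U;
  lieDl : forall (U : opens X) (x x' y : TA U),
    lie (x + x') y = lie x y + lie x' y;
  lieDr : forall (U : opens X) (x y y' : TA U),
    lie x (y + y') = lie x y + lie x y';
  lie_res : forall (U V : opens X) (h : V `<=` U) (x y : TA U),
    lie (mres h x) (mres h y) = mres h (lie x y);
  lie_tens : forall (U : opens X) (a b : A U) (t u : vfield U),
    lie (tens a t) (tens b u) =
      tens (a * dact t b) u - tens (b * dact u a) t
      + tens (a * b) (vf_bracket t u) }.

Definition sgn (R : pzRingType) (n : int) : R := (-1) ^+ `|n|%N.
Arguments sgn {R} n.

(* [deg n U x] : x is a section over U of the component of degree n. The sheaf
   G is the direct sum of its components in the category of sheaves, so that
   a section is a finite sum of homogeneous ones only locally. *)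
Record graded_algebra (k : fieldType) (X : topologicalType) (G : ringSheaf X)
    (kst : forall U : opens X, {rmorphism k -> G U})
    (deg : int -> forall U : opens X, G U -> Prop) : Prop := GradedAlgebra {
  kst_res : forall (U V : opens X) (h : V `<=` U) c,
    rres h (kst U c) = kst V c;
  deg0 : forall n (U : opens X), deg n U 0;
  degB : forall n (U : opens X) x y, deg n U x -> deg n U y -> deg n U (x - y);
  deg_kst : forall (U : opens X) c, deg 0 U (kst U c);
  degM : forall m n (U : opens X) x y,
    deg m U x -> deg n U y -> deg (m + n) U (x * y);
  deg_res : forall n (U V : opens X) (h : V `<=` U) x,
    deg n U x -> deg n V (rres h x);
  deg_loc : forall n (U : opens X) (x : G U),
    (forall p, oset U p -> exists (V : opens X) (h : V `<=` U),
       oset V p /\ deg n V (rres h x)) -> deg n U x;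
  deg_sum : forall (U : opens X) (x : G U) p, oset U p ->
    exists (V : opens X) (h : V `<=` U) (s : seq int) (c : int -> G V),
      [/\ oset V p, uniq s, forall n, deg n V (c n) &
          rres h x = \sum_(n <- s) c n];
  deg_direct : forall (U : opens X) (s : seq int) (c : int -> G U), uniq s ->
    (forall n, deg n U (c n)) -> \sum_(n <- s) c n = 0 ->
    forall n, n \in s -> c n = 0 }.

Record gerstenhaber (k : fieldType) (X : topologicalType) (G : ringSheaf X)
    (kst : forall U : opens X, {rmorphism k -> G U})
    (deg : int -> forall U : opens X, G U -> Prop)
    (br : forall U : opens X, G U -> G U -> G U) : Prop := Gerstenhaber {
  ger_graded : graded_algebra kst deg;
  ger_comm : forall i j (U : opens X) (a b : G U), deg i U a -> deg j U b ->
    a * b = sgn (i * j) * (b * a);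
  br_res : forall (U V : opens X) (h : V `<=` U) (a b : G U),
    br V (rres h a) (rres h b) = rres h (br U a b);
  brDl : forall (U : opens X) (a a' b : G U),
    br U (a + a') b = br U a b + br U a' b;
  brDr : forall (U : opens X) (a b b' : G U),
    br U a (b + b') = br U a b + br U a b';
  brZl : forall (U : opens X) c (a b : G U),
    br U (kst U c * a) b = kst U c * br U a b;
  brZr : forall (U : opens X) c (a b : G U),
    br U a (kst U c * b) = kst U c * br U a b;
  br_deg : forall i j (U : opens X) (a b : G U), deg i U a -> deg j U b ->
    deg (i + j + 1) U (br U a b);
  br_anti : forall i j (U : opens X) (a b : G U), deg i U a -> deg j U b ->
    br U a b = - (sgn ((i - 1) * (j - 1)) * br U b a);
  br_jacobi : forall i j l (U : opens X) (a b c : G U),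
    deg i U a -> deg j U b -> deg l U c ->
    br U a (br U b c) =
      br U (br U a b) c + sgn ((i - 1) * (j - 1)) * br U b (br U a c);
  br_poisson : forall i j l (U : opens X) (a b c : G U),
    deg i U a -> deg j U b -> deg l U c ->
    br U a (b * c) = br U a b * c + sgn ((i - 1) * j) * (b * br U a c) }.

Record differential (k : fieldType) (X : topologicalType) (G : ringSheaf X)
    (kst : forall U : opens X, {rmorphism k -> G U})
    (deg : int -> forall U : opens X, G U -> Prop)
    (d : forall U : opens X, G U -> G U) : Prop := Differential {
  d_res : forall (U V : opens X) (h : V `<=` U) (a : G U),
    d V (rres h a) = rres h (d U a);
  dD : forall (U : opens X) (a b : G U), d U (a + b) = d U a + d U b;
  dZ : forall (U : opens X) c (a : G U), d U (kst U c * a) = kst U c * d U a;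
  d_deg : forall i (U : opens X) (a : G U), deg i U a -> deg (i + 1) U (d U a);
  d_square : forall (U : opens X) (a : G U), d U (d U a) = 0 }.

Record batalin_vilkovisky (k : fieldType) (X : topologicalType)
    (G : ringSheaf X) (kst : forall U : opens X, {rmorphism k -> G U})
    (deg : int -> forall U : opens X, G U -> Prop)
    (br : forall U : opens X, G U -> G U -> G U)
    (d : forall U : opens X, G U -> G U) : Prop := BatalinVilkovisky {
  bv_ger : gerstenhaber kst deg br;
  bv_diff : differential kst deg d;
  bv_br : forall i j (U : opens X) (a b : G U), deg i U a -> deg j U b ->
    sgn i * br U a b = d U (a * b) - d U a * b - sgn i * (a * d U b) }.

(* A sheaf of A-algebras B with an A-linear map T_A -> B of square zero. *)
Record square_zero_map (k : fieldType) (X : scheme k) (A : DX_algebra X)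
    (T : tangent_algebroid A) (B : ringSheaf X)
    (j0 : forall U : opens X, {rmorphism A U -> B U})
    (j1 : forall U : opens X, {additive T U -> B U}) : Prop := SquareZeroMap {
  sq_res0 : forall (U V : opens X) (h : V `<=` U) (a : A U),
    j0 V (cres h a) = rres h (j0 U a);
  sq_central : forall (U : opens X) (a : A U) (x : B U),
    j0 U a * x = x * j0 U a;
  sq_res1 : forall (U V : opens X) (h : V `<=` U) (x : T U),
    j1 V (mres h x) = rres h (j1 U x);
  sq_linear : forall (U : opens X) (a : A U) (x : T U),
    j1 U (a *: x) = j0 U a * j1 U x;
  sq_zero : forall (U : opens X) (x : T U), j1 U x * j1 U x = 0 }.

Record exterior_algebra (k : fieldType) (X : scheme k) (A : DX_algebra X)
    (T : tangent_algebroid A) := ExteriorAlgebra {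
  ext :> ringSheaf X;
  ext0 : forall U : opens X, {rmorphism A U -> ext U};
  ext1 : forall U : opens X, {additive T U -> ext U};
  ext_sq : square_zero_map ext0 ext1;
  ext_univ : forall (B : ringSheaf X)
    (j0 : forall U : opens X, {rmorphism A U -> B U})
    (j1 : forall U : opens X, {additive T U -> B U}), square_zero_map j0 j1 ->
    exists phi : forall U : opens X, {rmorphism ext U -> B U},
      [/\ forall (U V : opens X) (h : V `<=` U) (x : ext U),
            phi V (rres h x) = rres h (phi U x),
          forall (U : opens X) (a : A U), phi U (ext0 U a) = j0 U a,
          forall (U : opens X) (x : T U), phi U (ext1 U x) = j1 U x &
          forall psi : forall U : opens X, {rmorphism ext U -> B U},
            (forall (U V : opens X) (h : V `<=` U) (x : ext U),
               psi V (rres h x) = rres h (psi U x)) ->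
            (forall (U : opens X) (a : A U), psi U (ext0 U a) = j0 U a) ->
            (forall (U : opens X) (x : T U), psi U (ext1 U x) = j1 U x) ->
            forall (U : opens X) (x : ext U), psi U x = phi U x] }.

Definition ext_kst (k : fieldType) (X : scheme k) (A : DX_algebra X)
    (T : tangent_algebroid A) (L : exterior_algebra T) (U : opens X) :
    {rmorphism k -> L U} :=
  ext0 L U \o (alg_unit A U \o kcst U).

(* The grading with A in degree 0 and T_A in degree -1, and the Gerstenhaber
   bracket; both are determined by these conditions since A and T_A generate. *)
Record polyvector_gerstenhaber (k : fieldType) (X : scheme k)
    (A : DX_algebra X) (T : tangent_algebroid A) (L : exterior_algebra T)
    (deg : int -> forall U : opens X, L U -> Prop)
    (br : forall U : opens X, L U -> L U -> L U) : Prop :=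
    PolyvectorGerstenhaber {
  pv_ger : gerstenhaber (ext_kst L) deg br;
  pv_deg0 : forall (U : opens X) (a : A U), deg 0 U (ext0 L U a);
  pv_deg1 : forall (U : opens X) (x : T U), deg (-1) U (ext1 L U x);
  pv_anchor : forall (U : opens X) (x : T U) (a : A U),
    br U (ext1 L U x) (ext0 L U a) = ext0 L U (anchor x a);
  pv_lie : forall (U : opens X) (x y : T U),
    br U (ext1 L U x) (ext1 L U y) = ext1 L U (lie x y) }.

Record DA_relations (k : fieldType) (X : scheme k) (A : DX_algebra X)
    (B : ringSheaf X) (j : forall U : opens X, {rmorphism A U -> B U})
    (p : forall U : opens X, {additive vfield U -> B U}) : Prop :=
    DARelations {
  rel_resA : forall (U V : opens X) (h : V `<=` U) (a : A U),
    j V (cres h a) = rres h (j U a);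
  rel_resT : forall (U V : opens X) (h : V `<=` U) (t : vfield U),
    p V (vf_res h t) = rres h (p U t);
  rel_O : forall (U : opens X) (f : \O_X U) (t : vfield U),
    j U (alg_unit A U f) * p U t = p U (f *: t);
  rel_TA : forall (U : opens X) (t : vfield U) (a : A U),
    p U t * j U a - j U a * p U t = j U (dact t a);
  rel_TT : forall (U : opens X) (t u : vfield U),
    p U t * p U u - p U u * p U t = p U (vf_bracket t u) }.

(* Generators and relations are expressed by the universal property. It is
   enough to ask for rings: k is central in D_A since it commutes with the
   generators. *)
Record DA_sheaf (k : fieldType) (X : scheme k) (A : DX_algebra X) := DASheaf {
  DA :> ringSheaf X;
  genA : forall U : opens X, {rmorphism A U -> DA U};
  genT : forall U : opens X, {additive vfield U -> DA U};
  DA_rel : DA_relations genA genT;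
  DA_univ : forall (B : ringSheaf X)
    (j : forall U : opens X, {rmorphism A U -> B U})
    (p : forall U : opens X, {additive vfield U -> B U}), DA_relations j p ->
    exists phi : forall U : opens X, {rmorphism DA U -> B U},
      [/\ forall (U V : opens X) (h : V `<=` U) (x : DA U),
            phi V (rres h x) = rres h (phi U x),
          forall (U : opens X) (a : A U), phi U (genA U a) = j U a,
          forall (U : opens X) (t : vfield U), phi U (genT U t) = p U t &
          forall psi : forall U : opens X, {rmorphism DA U -> B U},
            (forall (U V : opens X) (h : V `<=` U) (x : DA U),
               psi V (rres h x) = rres h (psi U x)) ->
            (forall (U : opens X) (a : A U), psi U (genA U a) = j U a) ->
            (forall (U : opens X) (t : vfield U), psi U (genT U t) = p U t) ->
            forall (U : opens X) (x : DA U), psi U x = phi U x] }.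

(* A right D_A-module structure on A inducing the multiplication of A. *)
Record CY_structure (k : fieldType) (X : scheme k) (A : DX_algebra X)
    (D : DA_sheaf A) := CYStructure {
  ract : forall U : opens X, A U -> D U -> A U;
  ractDl : forall (U : opens X) (a b : A U) (P : D U),
    ract (a + b) P = ract a P + ract b P;
  ractDr : forall (U : opens X) (a : A U) (P Q : D U),
    ract a (P + Q) = ract a P + ract a Q;
  ract1 : forall (U : opens X) (a : A U), ract a (1 : D U) = a;
  ractM : forall (U : opens X) (a : A U) (P Q : D U),
    ract a (P * Q) = ract (ract a P) Q;
  ract_res : forall (U V : opens X) (h : V `<=` U) (a : A U) (P : D U),
    ract (cres h a) (rres h P) = cres h (ract a P);
  ractA : forall (U : opens X) (a b : A U), ract a (genA D U b) = a * b }.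

Record associated_map (k : fieldType) (X : scheme k) (A : DX_algebra X)
    (T : tangent_algebroid A) (D : DA_sheaf A) (C : CY_structure D)
    (nabla : forall U : opens X, {additive T U -> A U}) : Prop :=
    AssociatedMap {
  nabla_res : forall (U V : opens X) (h : V `<=` U) (x : T U),
    nabla V (mres h x) = cres h (nabla U x);
  nabla_tens : forall (U : opens X) (a : A U) (t : vfield U),
    nabla U (tens T a t) = ract C a (genT D U t) }.

(* Main.v *)
From HB Require Import structures.
Require Import Defs.
From mathcomp Require Import all_boot all_order all_algebra.
From mathcomp Require Import all_classical topology.
From mathcomp Require Import zify ring.

(* A BV differential d satisfies d(ab) = da b + s(a) db + [s(a), b], where
   s(a) = (-1)^|a| a. By the Poisson rule (a, b) |-> [s(a), b] is a Hochschild
   2-cocycle, so that L x L becomes a sheaf of rings under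
     (a, u)(b, v) = (ab, ub + s(a)v + [s(a), b]),
   and d is the same thing as a ring morphism a |-> (a, da) splitting the first
   projection. The universal property of the exterior algebra yields the
   splitting with a |-> (a, 0) on A and x |-> (x, nabla x) on T_A; its relations
   hold because nabla(ax) = a nabla(x) - x(a) and [x, x] = 0. As L is locally
   spanned by products of sections of T_A over A, the identity d^2 = 0 follows
   by induction on such products from
     d[a, c] = - [a, dc],  d[x, c] = [nabla x, c] + [x, dc],
   which are themselves proved by induction on c from the Jacobi identity and
   the flatness nabla[x, y] = x(nabla y) - y(nabla x) of the right connection.
   Uniqueness is again an induction on products, starting from d = 0 on A, which
   holds because L has no sections of positive degree. *)

Set Implicit Arguments.
Unset Strict Implicit.
Unset Printing Implicit Defensive.
Import GRing.Theory.
Local Open Scope classical_set_scope.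
Local Open Scope ring_scope.

(** * Separatedness of sheaves *)

Lemma sheaf_sep (X : topologicalType) (F : opens X -> Type)
    (r : forall U V : opens X, V `<=` U -> F U -> F V) :
    (forall (U V W : opens X) (hVU : V `<=` U) (hWV : W `<=` V)
      (hWU : W `<=` U) s, r _ _ hWV (r _ _ hVU s) = r _ _ hWU s) ->
    sheaf_axiom r ->
  forall (U : opens X) (x y : F U),
  (forall p, oset U p -> exists (V : opens X) (h : V `<=` U),
     oset V p /\ r _ _ h x = r _ _ h y) -> x = y.
Proof.
move=> rc shF U x y xy.
(* The cover consists of all opens on which the two sections agree. Both sections glue the
   restrictions of [x] to it, so uniqueness of gluing identifies them. *)
pose I := {V : opens X | exists h : V `<=` U, r _ _ h x = r _ _ h y}.
have hI (i : I) : projT1 i `<=` U by case: i => V /= [].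
have [|i j W hi hj|t [_ tu]] := shF I _ U hI (fun i => r _ _ (hI i) x).
- move=> p /xy[V [h [Vp e]]].
  by exists (exist _ V (ex_intro _ h e)).
- have hW : W `<=` U by apply: subset_trans hi (hI i).
  by rewrite !(rc _ _ _ _ _ hW).
have <- := tu x (fun=> erefl); apply: tu => i.
case: (projT2 i) => h e; rewrite (_ : hI i = h) ?e //; exact: Prop_irrelevance.
Qed.

(** * Subsheaves *)

Record lsub (T : Type) (S : set T) := LSub { lsval : T; lsvalP : S lsval }.

Lemma lsval_inj (T : Type) (S : set T) : injective (@lsval T S).
Proof.
case=> [x p] [y q] /= e; move: p; rewrite e => p.
by congr LSub; exact: Prop_irrelevance.
Qed.

(** Sections are glued in [F]; as membership in [S] is a local condition, the glued section lies in
    [S] again. *)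
Lemma lsub_sheaf_axiom (X : topologicalType) (F : opens X -> Type)
    (r : forall U V : opens X, V `<=` U -> F U -> F V)
    (S : forall U, set (F U))
    (rS : forall (U V : opens X) (h : V `<=` U) x, S U x -> S V (r _ _ h x)) :
    sheaf_axiom r ->
    (forall (U : opens X) (x : F U), (forall p, oset U p ->
      exists (V : opens X) (h : V `<=` U), oset V p /\ S V (r _ _ h x)) ->
      S U x) ->
  @sheaf_axiom X (fun U => lsub (S U))
    (fun U V h x => LSub (rS U V h (lsval x) (lsvalP x))).
Proof.
move=> shF Sl I V U hV s cov ag.
have [|t [tr tu]] := shF I V U hV (fun i => lsval (s i)) cov.
  by move=> i j W hi hj; exact: (congr1 (@lsval _ _) (ag i j W hi hj)).
have St : S U t.
  apply: Sl => p /cov[i Vp]; exists (V i), (hV i); rewrite tr.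
  by split=> //; exact: lsvalP.
exists (LSub St); split=> [i|t' h]; apply: lsval_inj => //=.
by apply: tu => i; rewrite -(h i).
Qed.

(** The condition [sg_loc] makes such a family a sheaf, so that it can serve as the target in a
    universal property. *)
Record subgroup_sheaf (X : topologicalType) (G : abSheaf X) := SubgroupSheaf {
  sgsec :> forall U, set (G U);
  sg0 : forall U, sgsec (0 : G U);
  sgB : forall U (x y : G U), sgsec x -> sgsec y -> sgsec (x - y);
  sg_res : forall (U V : opens X) (h : V `<=` U) (x : G U),
    sgsec x -> sgsec (ares h x);
  sg_loc : forall (U : opens X) (x : G U), (forall p, oset U p ->
      exists (V : opens X) (h : V `<=` U), oset V p /\ sgsec (ares h x)) ->
    sgsec x }.

Record subring_sheaf (X : topologicalType) (G : ringSheaf X) := SubringSheaf {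
  srsec :> forall U, set (G U);
  sr1 : forall U, srsec (1 : G U);
  srB : forall U (x y : G U), srsec x -> srsec y -> srsec (x - y);
  srM : forall U (x y : G U), srsec x -> srsec y -> srsec (x * y);
  sr_res : forall (U V : opens X) (h : V `<=` U) (x : G U),
    srsec x -> srsec (rres h x);
  sr_loc : forall (U : opens X) (x : G U), (forall p, oset U p ->
      exists (V : opens X) (h : V `<=` U), oset V p /\ srsec (rres h x)) ->
    srsec x }.

Section SubAb.
Variables (X : topologicalType) (G : abSheaf X) (S : subgroup_sheaf G).

Definition sgs (U : opens X) := lsub (S U).

HB.instance Definition _ U := gen_eqMixin (sgs U).
HB.instance Definition _ U := gen_choiceMixin (sgs U).

(** Closure is given for zero and differences, so opposites and sums are built from subtraction: x +
    y is x - (0 - y). *)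
Definition sgs_sub U (x y : sgs U) : sgs U := LSub (sgB (lsvalP x) (lsvalP y)).
Definition sgs_zero U : sgs U := LSub (sg0 S U).
Definition sgs_opp U (x : sgs U) : sgs U := sgs_sub (sgs_zero U) x.
Definition sgs_add U (x y : sgs U) : sgs U := sgs_sub x (sgs_opp y).

Fact sgs_addE U (x y : sgs U) : lsval (sgs_add x y) = lsval x + lsval y.
Proof. by rewrite /= sub0r opprK. Qed.
Fact sgs_addA U : associative (@sgs_add U).
Proof. by move=> *; apply: lsval_inj; rewrite !sgs_addE addrA. Qed.
Fact sgs_addC U : commutative (@sgs_add U).
Proof. by move=> *; apply: lsval_inj; rewrite !sgs_addE addrC. Qed.
Fact sgs_add0 U : left_id (@sgs_zero U) (@sgs_add U).
Proof. by move=> *; apply: lsval_inj; rewrite !sgs_addE add0r. Qed.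
Fact sgs_addN U : left_inverse (@sgs_zero U) (@sgs_opp U) (@sgs_add U).
Proof. by move=> *; apply: lsval_inj; rewrite !sgs_addE /= sub0r addNr. Qed.

HB.instance Definition _ U := GRing.isZmodule.Build (sgs U)
  (@sgs_addA U) (@sgs_addC U) (@sgs_add0 U) (@sgs_addN U).

Definition sgs_val U (x : sgs U) : G U := lsval x.

Fact sgs_val_additive U : zmod_morphism (@sgs_val U).
Proof. by move=> x y; rewrite /sgs_val sgs_addE /= sub0r. Qed.

HB.instance Definition _ U :=
  GRing.isZmodMorphism.Build (sgs U) (G U) (@sgs_val U) (@sgs_val_additive U).

Definition sgs_res (U V : opens X) (h : V `<=` U) (x : sgs U) : sgs V :=
  LSub (sg_res h (lsvalP x)).

Fact sgs_res_additive (U V : opens X) (h : V `<=` U) :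
  zmod_morphism (sgs_res h).
Proof.
move=> x y; apply: lsval_inj.
change (ares h (sgs_val (x - y)) = sgs_val (sgs_res h x - sgs_res h y)).
by rewrite (raddfB (@sgs_val U)) (raddfB (@sgs_val V)) (raddfB (ares h)).
Qed.

HB.instance Definition _ (U V : opens X) (h : V `<=` U) :=
  GRing.isZmodMorphism.Build (sgs U) (sgs V) (sgs_res h) (sgs_res_additive h).

Definition sub_abSheaf : abSheaf X.
Proof.
exists (fun U => sgs U) (fun U V h => sgs_res h : {additive _ -> _}).
- by move=> U h s; apply: lsval_inj; exact: ares_id.
- by move=> U V W hVU hWV hWU s; apply: lsval_inj; exact: ares_comp.
- exact (@lsub_sheaf_axiom X (fun U => G U) (fun U V h => ares h) S
    (@sg_res _ _ S) (@asec_sheaf _ G) (@sg_loc _ _ S)).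
Defined.

End SubAb.

Section SubRing.
Variables (X : topologicalType) (G : ringSheaf X) (S : subring_sheaf G).

Definition srs (U : opens X) := lsub (S U).

HB.instance Definition _ U := gen_eqMixin (srs U).
HB.instance Definition _ U := gen_choiceMixin (srs U).

Fact sr0 U : S U 0.
Proof. by rewrite -(subrr 1); apply: srB; exact: sr1. Qed.

Definition srs_sub U (x y : srs U) : srs U := LSub (srB (lsvalP x) (lsvalP y)).
Definition srs_zero U : srs U := LSub (sr0 U).
Definition srs_opp U (x : srs U) : srs U := srs_sub (srs_zero U) x.
Definition srs_add U (x y : srs U) : srs U := srs_sub x (srs_opp y).
Definition srs_one U : srs U := LSub (sr1 S U).
Definition srs_mul U (x y : srs U) : srs U := LSub (srM (lsvalP x) (lsvalP y)).

Fact srs_addE U (x y : srs U) : lsval (srs_add x y) = lsval x + lsval y.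
Proof. by rewrite /= sub0r opprK. Qed.
Fact srs_addA U : associative (@srs_add U).
Proof. by move=> *; apply: lsval_inj; rewrite !srs_addE addrA. Qed.
Fact srs_addC U : commutative (@srs_add U).
Proof. by move=> *; apply: lsval_inj; rewrite !srs_addE addrC. Qed.
Fact srs_add0 U : left_id (@srs_zero U) (@srs_add U).
Proof. by move=> *; apply: lsval_inj; rewrite !srs_addE add0r. Qed.
Fact srs_addN U : left_inverse (@srs_zero U) (@srs_opp U) (@srs_add U).
Proof. by move=> *; apply: lsval_inj; rewrite !srs_addE /= sub0r addNr. Qed.

HB.instance Definition _ U := GRing.isZmodule.Build (srs U)
  (@srs_addA U) (@srs_addC U) (@srs_add0 U) (@srs_addN U).

Fact srs_mulA U : associative (@srs_mul U).
Proof. by move=> *; apply: lsval_inj; rewrite /= mulrA. Qed.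
Fact srs_mul1 U : left_id (srs_one U) (@srs_mul U).
Proof. by move=> *; apply: lsval_inj; rewrite /= mul1r. Qed.
Fact srs_mul1r U : right_id (srs_one U) (@srs_mul U).
Proof. by move=> *; apply: lsval_inj; rewrite /= mulr1. Qed.
Fact srs_valD U (x y : srs U) : lsval (x + y) = lsval x + lsval y.
Proof. exact: srs_addE. Qed.
Fact srs_mulDl U : left_distributive (@srs_mul U) +%R.
Proof.
move=> x y z; apply: lsval_inj; rewrite srs_valD.
by rewrite [LHS](congr1 ( *%R^~ _) (srs_valD x y)) mulrDl.
Qed.
Fact srs_mulDr U : right_distributive (@srs_mul U) +%R.
Proof.
move=> x y z; apply: lsval_inj; rewrite srs_valD.
by rewrite [LHS](congr1 ( *%R _) (srs_valD y z)) mulrDr.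
Qed.

HB.instance Definition _ U := GRing.Zmodule_isPzRing.Build (srs U)
  (@srs_mulA U) (@srs_mul1 U) (@srs_mul1r U) (@srs_mulDl U) (@srs_mulDr U).

Definition srs_val U (x : srs U) : G U := lsval x.

Fact srs_val_additive U : zmod_morphism (@srs_val U).
Proof. by move=> x y; rewrite /srs_val srs_addE /= sub0r. Qed.
Fact srs_val_monoid U : monoid_morphism (@srs_val U).
Proof. by []. Qed.

HB.instance Definition _ U :=
  GRing.isZmodMorphism.Build (srs U) (G U) (@srs_val U) (@srs_val_additive U).
HB.instance Definition _ U :=
  GRing.isMonoidMorphism.Build (srs U) (G U) (@srs_val U) (@srs_val_monoid U).

Definition srs_res (U V : opens X) (h : V `<=` U) (x : srs U) : srs V :=
  LSub (sr_res h (lsvalP x)).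

Fact srs_res_additive (U V : opens X) (h : V `<=` U) :
  zmod_morphism (srs_res h).
Proof.
move=> x y; apply: lsval_inj.
change (rres h (srs_val (x - y)) = srs_val (srs_res h x - srs_res h y)).
by rewrite (raddfB (@srs_val U)) (raddfB (@srs_val V)) (raddfB (rres h)).
Qed.
Fact srs_res_monoid (U V : opens X) (h : V `<=` U) :
  monoid_morphism (srs_res h).
Proof.
by split=> [|x y]; apply: lsval_inj; rewrite /= ?rmorph1 ?rmorphM.
Qed.

HB.instance Definition _ (U V : opens X) (h : V `<=` U) :=
  GRing.isZmodMorphism.Build (srs U) (srs V) (srs_res h) (srs_res_additive h).
HB.instance Definition _ (U V : opens X) (h : V `<=` U) :=
  GRing.isMonoidMorphism.Build (srs U) (srs V) (srs_res h) (srs_res_monoid h).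

Definition sub_ringSheaf : ringSheaf X.
Proof.
exists (fun U => srs U) (fun U V h => srs_res h : {rmorphism _ -> _}).
- by move=> U h s; apply: lsval_inj; exact: rres_id.
- by move=> U V W hVU hWV hWU s; apply: lsval_inj; exact: rres_comp.
- exact (@lsub_sheaf_axiom X (fun U => G U) (fun U V h => rres h) S
    (@sr_res _ _ S) (@rsec_sheaf _ G) (@sr_loc _ _ S)).
Defined.

End SubRing.

(** * Induction principles for the tangent algebroid and its exterior algebra *)

Definition mod_abSheaf (X : topologicalType) (R : comRingSheaf X)
  (M : modSheaf R) : abSheaf X :=
  @AbSheaf X (fun U => M U) (fun U V h => mres h) (@mres_id _ _ M)
    (@mres_comp _ _ M) (@msec_sheaf _ _ M).

(** If [S] contains the generators, the universal property gives a map from T_A to [S]. Its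
    composite with the inclusion fixes the generators, hence is the identity by uniqueness, and
    every section lies in [S]. *)
Lemma tangent_ind (k : fieldType) (X : scheme k) (A : DX_algebra X)
    (T : tangent_algebroid A) (S : subgroup_sheaf (mod_abSheaf T)) :
  (forall (U : opens X) (a : A U) (t : vfield U), S U (tens T a t)) ->
  forall (U : opens X) (x : T U), S U x.
Proof.
move=> St U x.
have [|phi [phir phit _]] := @tens_univ _ _ _ T (sub_abSheaf S)
  (fun U a t => LSub (St U a t)).
  have [bDl bDr bO br] := tens_balanced T.
  split.
  - by move=> V a a' t; apply: lsval_inj; rewrite /= bDl sub0r opprK.
  - by move=> V a t t'; apply: lsval_inj; rewrite /= bDr sub0r opprK.
  - by move=> V f a t; apply: lsval_inj; exact: bO.
  - by move=> V W h a t; apply: lsval_inj; exact: br.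
have [|psi [_ _ psi_uniq]] :=
    @tens_univ _ _ _ T (mod_abSheaf T) (@tens _ _ _ T).
  exact: tens_balanced.
have e1 := psi_uniq (fun U => idfun : {additive T U -> T U}).
have e2 := psi_uniq
  (fun U => @sgs_val _ _ S U \o phi U : {additive T U -> T U}).
have -> : x = sgs_val (phi U x).
  rewrite [LHS]e1 // -e2 // => [V W h y|V a t] /=.
    by rewrite phir.
  by rewrite phit.
exact: lsvalP.
Qed.

(** The same factorization argument, now with the universal property of the exterior algebra among
    sheaves of rings. *)
Lemma exterior_ind (k : fieldType) (X : scheme k) (A : DX_algebra X)
    (T : tangent_algebroid A) (L : exterior_algebra T) (S : subring_sheaf L) :
  (forall (U : opens X) (a : A U), S U (ext0 L U a)) ->
  (forall (U : opens X) (x : T U), S U (ext1 L U x)) ->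
  forall (U : opens X) (x : L U), S U x.
Proof.
move=> S0 S1 U x.
have [sr0 sc sr1 sl sz] := ext_sq L.
pose f0 V (a : A V) : srs S V := LSub (S0 V a).
pose f1 V (a : T V) : srs S V := LSub (S1 V a).
have f0a V : zmod_morphism (@f0 V).
  by move=> a b; apply: lsval_inj; rewrite /= raddfB sub0r opprB subr0.
have f0m V : monoid_morphism (@f0 V).
  by split=> [|a b]; apply: lsval_inj; rewrite /= ?rmorph1 ?rmorphM.
have f1a V : zmod_morphism (@f1 V).
  by move=> a b; apply: lsval_inj; rewrite /= raddfB sub0r opprB subr0.
pose j0 V : {rmorphism A V -> srs S V} := HB.pack (@f0 V)
  (GRing.isZmodMorphism.Build _ _ _ (f0a V))
  (GRing.isMonoidMorphism.Build _ _ _ (f0m V)).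
pose j1 V : {additive T V -> srs S V} := HB.pack (@f1 V)
  (GRing.isZmodMorphism.Build _ _ _ (f1a V)).
have [|phi [phir phi0 phi1 _]] := @ext_univ _ _ _ _ L (sub_ringSheaf S) j0 j1.
  split.
  - by move=> V W h a; apply: lsval_inj; exact: sr0.
  - by move=> V a y; apply: lsval_inj; exact: sc.
  - by move=> V W h a; apply: lsval_inj; exact: sr1.
  - by move=> V a y; apply: lsval_inj; exact: sl.
  - by move=> V y; apply: lsval_inj; exact: sz.
have [psi [_ _ _ psi_uniq]] := @ext_univ _ _ _ _ L _ _ _ (ext_sq L).
have e1 := psi_uniq (fun U => idfun : {rmorphism L U -> L U}).
pose v V : {rmorphism sub_ringSheaf S V -> L V} := @srs_val _ _ S V.
have e2 := psi_uniq (fun U => v U \o phi U : {rmorphism L U -> L U}).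
have -> : x = srs_val (phi U x).
  rewrite [LHS]e1 // -e2 // => [V W h y|V a|V a] /=.
  - by rewrite phir.
  - by rewrite phi0.
  - by rewrite phi1.
exact: lsvalP.
Qed.

(** * First-order deformations of sheaves of rings *)

(* First-order deformation of a sheaf of rings G with coefficients in G, on
   which G acts by multiplication on the right and through [twst] on the left;
   [twm_cocycle] says that [twm] is a Hochschild 2-cocycle. *)
Record twist (X : topologicalType) (G : ringSheaf X) := Twist {
  twst : forall U : opens X, {rmorphism G U -> G U};
  twm : forall U : opens X, G U -> G U -> G U;
  twst_res : forall (U V : opens X) (h : V `<=` U) (a : G U),
    twst V (rres h a) = rres h (twst U a);
  twm_res : forall (U V : opens X) (h : V `<=` U) (a b : G U),
    twm (rres h a) (rres h b) = rres h (twm a b);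
  twmDl : forall (U : opens X) (a a' b : G U),
    twm (a + a') b = twm a b + twm a' b;
  twmDr : forall (U : opens X) (a b b' : G U),
    twm a (b + b') = twm a b + twm a b';
  twm1l : forall (U : opens X) (a : G U), twm 1 a = 0;
  twm1r : forall (U : opens X) (a : G U), twm a 1 = 0;
  twm_cocycle : forall (U : opens X) (a b c : G U),
    twm a b * c + twm (a * b) c = twst U a * twm b c + twm a (b * c) }.

Section TwistedRing.
Variables (X : topologicalType) (G : ringSheaf X) (t : twist G).

(** The twist is a parameter of the type so that the ring structure declared on it can depend on the
    cocycle. *)
Definition tws of twist G := fun U : opens X => (G U * G U)%type.

HB.instance Definition _ U := GRing.Zmodule.on (tws t U).

Definition tws_one U : tws t U := (1, 0).
Definition tws_mul U (x y : tws t U) : tws t U :=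
  (x.1 * y.1, x.2 * y.1 + twst t U x.1 * y.2 + twm t x.1 y.1).

Fact tws_mulA U : associative (@tws_mul U).
Proof.
move=> [a u] [b v] [c w]; congr pair; rewrite /= ?mulrA //.
rewrite !mulrDl !mulrDr !mulrA rmorphM -!addrA; congr (_ + (_ + _)).
(* In the second component the terms containing [twm] match exactly by the cocycle identity; the
   others agree by associativity and multiplicativity of [twst]. *)
rewrite [RHS]addrCA -twm_cocycle addrCA.
by rewrite [X in _ + X]addrC; congr (_ + _); rewrite addrC.
Qed.
Fact tws_mul1 U : left_id (tws_one U) (@tws_mul U).
Proof.
move=> [a u].
by rewrite /tws_mul /= !mul1r rmorph1 mul0r mul1r twm1l add0r addr0.
Qed.
Fact tws_mul1r U : right_id (tws_one U) (@tws_mul U).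
Proof.
by move=> [a u]; rewrite /tws_mul /= !mulr1 mulr0 twm1r !addr0.
Qed.
Fact tws_mulDl U : left_distributive (@tws_mul U) +%R.
Proof.
move=> [a u] [b v] [c w]; congr pair; rewrite /= ?mulrDl //.
rewrite rmorphD mulrDl twmDl [RHS]addrACA; congr (_ + _).
by rewrite [RHS]addrACA.
Qed.
Fact tws_mulDr U : right_distributive (@tws_mul U) +%R.
Proof.
move=> [a u] [b v] [c w]; congr pair; rewrite /= ?mulrDr //.
by rewrite twmDr [RHS]addrACA; congr (_ + _); rewrite [RHS]addrACA.
Qed.

HB.instance Definition _ U := GRing.Zmodule_isPzRing.Build (tws t U)
  (@tws_mulA U) (@tws_mul1 U) (@tws_mul1r U) (@tws_mulDl U) (@tws_mulDr U).

Definition tws_res (U V : opens X) (h : V `<=` U) (x : tws t U) : tws t V :=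
  (rres h x.1, rres h x.2).

Fact tws_res_additive (U V : opens X) (h : V `<=` U) :
  zmod_morphism (tws_res h).
Proof. by move=> [a u] [b v]; rewrite /tws_res /= !raddfB. Qed.
Fact tws_res_monoid (U V : opens X) (h : V `<=` U) :
  monoid_morphism (tws_res h).
Proof.
split=> [|[a u] [b v]]; first by rewrite /tws_res /= rmorph1 rmorph0.
by congr pair; rewrite /= ?rmorphD ?rmorphM // -twst_res -twm_res.
Qed.

HB.instance Definition _ (U V : opens X) (h : V `<=` U) :=
  GRing.isZmodMorphism.Build (tws t U) (tws t V) (tws_res h)
    (tws_res_additive h).
HB.instance Definition _ (U V : opens X) (h : V `<=` U) :=
  GRing.isMonoidMorphism.Build (tws t U) (tws t V) (tws_res h)
    (tws_res_monoid h).

Definition twisted_ring : ringSheaf X.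
Proof.
exists (fun U => tws t U) (fun U V h => tws_res h : {rmorphism _ -> _}).
- by move=> U h [a u]; rewrite /= /tws_res /= !rres_id.
- move=> U V W hVU hWV hWU [a u].
  by rewrite /= /tws_res /= !(rres_comp hVU hWV hWU).
- move=> I V U hV s cov ag.
  have [|a [ar au]] := @rsec_sheaf _ G I V U hV (fun i => (s i).1) cov.
    by move=> i j W hi hj; exact: (congr1 fst (ag i j W hi hj)).
  have [|u [ur uu]] := @rsec_sheaf _ G I V U hV (fun i => (s i).2) cov.
    by move=> i j W hi hj; exact: (congr1 snd (ag i j W hi hj)).
  exists (a, u); split=> [i|[b v] h].
    by rewrite /= /tws_res /= ar ur -surjective_pairing.
  by congr pair; [apply: au|apply: uu] => i; rewrite -(h i).
Defined.

Definition tws_fst U (x : tws t U) : G U := x.1.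

Fact tws_fst_additive U : zmod_morphism (@tws_fst U).
Proof. by []. Qed.
Fact tws_fst_monoid U : monoid_morphism (@tws_fst U).
Proof. by []. Qed.

HB.instance Definition _ U :=
  GRing.isZmodMorphism.Build (tws t U) (G U) (@tws_fst U) (@tws_fst_additive U).
HB.instance Definition _ U :=
  GRing.isMonoidMorphism.Build (tws t U) (G U) (@tws_fst U) (@tws_fst_monoid U).

End TwistedRing.

(** * Local equality, intersections of opens, and signs *)

Lemma ringSheaf_sep (X : topologicalType) (G : ringSheaf X) (U : opens X)
    (x y : G U) :
  (forall p, oset U p -> exists (V : opens X) (h : V `<=` U),
     oset V p /\ rres h x = rres h y) -> x = y.
Proof.
exact: (sheaf_sep (@rres_comp _ G) (@rsec_sheaf _ G)).
Qed.

Definition opensI (X : topologicalType) (U V : opens X) : opens X :=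
  Opens (openI (@oset_open _ U) (@oset_open _ V)).

Lemma opensIl (X : topologicalType) (U V : opens X) : opensI U V `<=` U.
Proof. by move=> p []. Qed.

Lemma opensIr (X : topologicalType) (U V : opens X) : opensI U V `<=` V.
Proof. by move=> p []. Qed.

Lemma odd_abszD (m n : int) : odd `|(m + n)%R|%N = odd `|m|%N (+) odd `|n|%N.
Proof.
case: m n => [m|m] [n|n].
- by rewrite -PoszD /= oddD.
- by lia.
- by lia.
- by lia.
Qed.

Lemma odd_abszM (m n : int) : odd `|(m * n)%R|%N = odd `|m|%N && odd `|n|%N.
Proof. by rewrite abszM oddM. Qed.

(** Signs become functions of parities; with the two preceding lemmas, a sign identity reduces to a
    finite case check. *)
Lemma sgnE (R : pzRingType) (n : int) : sgn n = (-1) ^+ odd `|n|%N :> R.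
Proof. by rewrite signr_odd. Qed.

(** * Local structure and grading of the exterior algebra *)

Section Exterior.
Variables (k : fieldType) (X : scheme k) (A : DX_algebra X).
Variables (T : tangent_algebroid A) (L : exterior_algebra T).

(* [mono n x]: x is a sum of products of n sections of T_A with coefficients in
   A, all of them defined over the whole of U. *)
Inductive mono (U : opens X) : nat -> L U -> Prop :=
| mono0 n : mono n 0
| mono1 : mono 0 1
| monoD n x y : mono n x -> mono n y -> mono n (x + y)
| monoA n a x : mono n x -> mono n (ext0 L U a * x)
| monoT n y x : mono n x -> mono n.+1 (ext1 L U y * x).

(** The [j]-th summand has length [j], so that an expression of this kind displays its homogeneous
    components; since [mono j 0] holds, families can be padded by zeros. *)
Definition mono_sum (U : opens X) (x : L U) : Prop :=
  exists (N : nat) (y : nat -> L U),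
    (forall j, mono j (y j)) /\ x = \sum_(j < N) y j.

Lemma ext0_res (U V : opens X) (h : V `<=` U) (a : A U) :
  rres h (ext0 L U a) = ext0 L V (cres h a).
Proof. by rewrite (sq_res0 (ext_sq L)). Qed.

Lemma ext1_res (U V : opens X) (h : V `<=` U) (x : T U) :
  rres h (ext1 L U x) = ext1 L V (mres h x).
Proof. by rewrite (sq_res1 (ext_sq L)). Qed.

Lemma mono_res (U V : opens X) (h : V `<=` U) n (x : L U) :
  mono n x -> mono n (rres h x).
Proof.
elim=> {n x} [n||n x y _ Hx _ Hy|n a x _ Hx|n y x _ Hx].
- by rewrite rmorph0; exact: mono0.
- by rewrite rmorph1; exact: mono1.
- by rewrite rmorphD; exact: monoD.
- by rewrite rmorphM ext0_res; exact: monoA.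
- by rewrite rmorphM ext1_res; exact: monoT.
Qed.

Lemma monoN (U : opens X) n (x : L U) : mono n x -> mono n (- x).
Proof.
by move=> mx; rewrite -mulN1r -(rmorph1 (ext0 L U)) -rmorphN; exact: monoA.
Qed.

Lemma monoM (U : opens X) m n (x y : L U) :
  mono m x -> mono n y -> mono (m + n) (x * y).
Proof.
move=> mx my; elim: mx => {m x} [m||m x x' _ Hx _ Hy|m a x _ Hx|m x' x _ Hx].
- by rewrite mul0r; exact: mono0.
- by rewrite mul1r.
- by rewrite mulrDl; exact: monoD.
- by rewrite -mulrA; exact: monoA.
- by rewrite -mulrA addSn; exact: monoT.
Qed.

Lemma mono_sum_mono (U : opens X) n (x : L U) : mono n x -> mono_sum x.
Proof.
move=> mx; exists n.+1, (fun j => if j == n then x else 0); split=> [j|].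
  by case: eqP => [->|_] //; exact: mono0.
rewrite big_ord_recr /= eqxx big1 ?add0r // => i _.
by rewrite ltn_eqF.
Qed.

Lemma mono_sumD (U : opens X) (x y : L U) :
  mono_sum x -> mono_sum y -> mono_sum (x + y).
Proof.
have widen N (z : nat -> L U) M : (N <= M)%N ->
    \sum_(j < N) z j = \sum_(j < M) (if (j < N)%N then z j else 0).
  by move=> NM; rewrite (big_ord_widen M) // big_mkcond.
move=> [N [u [mu ->]]] [M [v [mv ->]]]; exists (maxn N M).
exists (fun j =>
  (if (j < N)%N then u j else 0) + (if (j < M)%N then v j else 0)).
split=> [j|]; first by apply: monoD; case: ifP => _ //; exact: mono0.
rewrite big_split (widen N _ (maxn N M)) ?leq_maxl //.
by rewrite (widen M _ (maxn N M)) // leq_maxr.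
Qed.

Lemma mono_sumM (U : opens X) (x y : L U) :
  mono_sum x -> mono_sum y -> mono_sum (x * y).
Proof.
move=> [N [u [mu ->]]] [M [v [mv ->]]].
have ms0 : mono_sum (0 : L U) by apply: (mono_sum_mono (n := 0)); exact: mono0.
rewrite mulr_suml; apply: big_ind => // [|i _]; first exact: mono_sumD.
rewrite mulr_sumr; apply: big_ind => // [|j _]; first exact: mono_sumD.
by apply: mono_sum_mono; exact: monoM.
Qed.

Lemma mono_sumB (U : opens X) (x y : L U) :
  mono_sum x -> mono_sum y -> mono_sum (x - y).
Proof.
move=> mx my; apply: mono_sumD => //; rewrite -mulN1r; apply: mono_sumM => //.
by apply: (mono_sum_mono (n := 0)); apply: monoN; exact: mono1.
Qed.

Lemma mono_sum_res (U V : opens X) (h : V `<=` U) (x : L U) :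
  mono_sum x -> mono_sum (rres h x).
Proof.
move=> [N [u [mu ->]]]; exists N, (fun j => rres h (u j)).
by split=> [j|]; [exact: mono_res|rewrite rmorph_sum].
Qed.

Definition loc_mono_sum (U : opens X) (x : L U) : Prop :=
  forall p, oset U p -> exists (V : opens X) (h : V `<=` U),
    oset V p /\ mono_sum (rres h x).

(** The two arguments have expansions on different neighbourhoods of a point; both are restricted to
    the intersection. *)
Lemma loc_mono_sum2 (op : forall U, L U -> L U -> L U) :
    (forall (U : opens X) (x y : L U), mono_sum x -> mono_sum y ->
       mono_sum (op U x y)) ->
    (forall (U V : opens X) (h : V `<=` U) (x y : L U),
       rres h (op U x y) = op V (rres h x) (rres h y)) ->
  forall (U : opens X) (x y : L U),
    loc_mono_sum x -> loc_mono_sum y -> loc_mono_sum (op U x y).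
Proof.
move=> opS opR U x y sx sy p Up.
have [V [h [Vp mx]]] := sx p Up; have [W [h' [Wp my]]] := sy p Up.
have hI : opensI V W `<=` U := subset_trans (@opensIl _ V W) h.
exists (opensI V W), hI; split=> //; rewrite opR; apply: opS.
  by rewrite -(rres_comp h (@opensIl _ V W)); exact: mono_sum_res.
by rewrite -(rres_comp h' (@opensIr _ V W)); exact: mono_sum_res.
Qed.

Definition mono_subring : subring_sheaf L.
Proof.
exists loc_mono_sum.
- move=> U p Up; exists U, (@subset_refl _ U); split=> //.
  by rewrite rmorph1; apply: (mono_sum_mono (n := 0)); exact: mono1.
- apply: (@loc_mono_sum2 (fun U x y => x - y)) => [|*]; last exact: rmorphB.
  exact: mono_sumB.
- apply: (@loc_mono_sum2 (fun U x y => x * y)) => [|*]; last exact: rmorphM.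
  exact: mono_sumM.
- move=> U V h x sx p Vp; have [W [hW [Wp mx]]] := sx p (h _ Vp).
  exists (opensI V W), (@opensIl _ V W); split=> //.
  have hI : opensI V W `<=` U := subset_trans (@opensIl _ V W) h.
  rewrite (rres_comp _ _ hI) -(rres_comp hW (@opensIr _ V W)).
  exact: mono_sum_res.
- move=> U x H p /H[V [h [Vp]]] /(_ p Vp)[W [hW [Wp mx]]].
  exists W, (subset_trans hW h); split=> //.
  by rewrite -(rres_comp h hW).
Defined.

(** The sections with local expansions form a subring sheaf containing A and T_A, hence exhaust the
    exterior algebra. *)
Lemma loc_mono (U : opens X) (x : L U) : loc_mono_sum x.
Proof.
apply: (@exterior_ind _ _ _ _ L mono_subring) => {U x} [U a|U x] p Up.
  exists U, (@subset_refl _ U); split=> //; rewrite rres_id -[ext0 _ _ _]mulr1.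
  by apply: mono_sum_mono; apply: monoA; exact: mono1.
exists U, (@subset_refl _ U); split=> //; rewrite rres_id -[ext1 _ _ _]mulr1.
by apply: mono_sum_mono; apply: monoT; exact: mono1.
Qed.

Definition local_pred (P : forall U : opens X, L U -> Prop) : Prop :=
  forall (U : opens X) (x : L U), (forall p, oset U p ->
    exists (V : opens X) (h : V `<=` U), oset V p /\ P V (rres h x)) -> P U x.

(** Induction on the local expansions into products. The case of the zero section comes from
    multiplying 1 by 0 in A. *)
Lemma ext_rec (P : forall U : opens X, L U -> Prop) :
    local_pred P ->
    (forall (U : opens X) (x y : L U), P U x -> P U y -> P U (x + y)) ->
    (forall U : opens X, P U 1) ->
    (forall (U : opens X) a (x : L U), P U x -> P U (ext0 L U a * x)) ->
    (forall (U : opens X) y (x : L U), P U x -> P U (ext1 L U y * x)) ->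
  forall (U : opens X) (x : L U), P U x.
Proof.
move=> Pl PD P1 PA PT U x; apply: Pl => p Up.
have [V [h [Vp [N [y [my xE]]]]]] := loc_mono x Up.
exists V, h; split=> //; rewrite {}xE.
have P0 : P V 0 by rewrite -(mul0r 1) -(rmorph0 (ext0 L V)); exact: PA.
apply: big_ind => // [z w|j _]; first exact: PD.
elim: (my j) => {j} [n||n z w _ Pz _ Pw|n a z _|n w z _] //.
- exact: PD.
- exact: PA.
- exact: PT.
Qed.

Variables (deg : int -> forall U : opens X, L U -> Prop).
Variable (br : forall U : opens X, L U -> L U -> L U).
Hypothesis hL : polyvector_gerstenhaber deg br.
Arguments br {U}.

Let ger := pv_ger hL.
Let gra := ger_graded ger.

Lemma deg_opp n (U : opens X) (x : L U) : deg n x -> deg n (- x).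
Proof.
by rewrite -(sub0r x) => dx; apply: (degB gra) => //; exact: deg0 gra _ _.
Qed.

Lemma deg_add n (U : opens X) (x y : L U) : deg n x -> deg n y -> deg n (x + y).
Proof.
by move=> dx dy; rewrite -(opprK y); apply: (degB gra) => //; exact: deg_opp.
Qed.

Lemma deg_mono n (U : opens X) (x : L U) : mono n x -> deg (- n%:Z) x.
Proof.
elim=> {n x} [n||n x y _ Hx _ Hy|n a x _ Hx|n y x _ Hx].
- exact: deg0 gra _ _.
- by rewrite oppr0 -(rmorph1 (ext_kst L U)); exact: (deg_kst gra).
- exact: deg_add.
- by rewrite -(add0r (- _)); apply: (degM gra) => //; exact: (pv_deg0 hL).
- rewrite -add1n PoszD opprD; apply: (degM gra) => //.
  exact: (pv_deg1 hL).
Qed.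

(** Comparing a homogeneous section with the components of its local expansion, directness of the
    grading leaves only the component of degree n. If no summand has that degree, the restriction
    vanishes, which is the second alternative. *)
Lemma deg_loc_mono n (U : opens X) (x : L U) : deg n x ->
  forall p, oset U p -> exists (V : opens X) (h : V `<=` U), oset V p /\
    exists2 j, mono j (rres h x) & n = - j%:Z \/ rres h x = 0.
Proof.
move=> dx p Up; have [V [h [Vp [N [y [my xE]]]]]] := loc_mono x Up.
exists V, h; split=> //; move: (deg_res gra h dx) xE.
move: (rres h x) => z dz zE.
pose s := undup (n :: [seq - j%:Z | j <- iota 0 N]).
(* [c m] is the component of degree [m] of the expansion minus that of [z]. These differences add up
   to zero, so each of them is zero, and the one at [n] gives the claim. *)
pose c m := (if m \in [seq - j%:Z | j <- iota 0 N] then y `|m|%N else 0)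
            - (if m == n then z else 0).
have cd m : deg m (c m).
  apply: (degB gra).
    case: ifP => [/mapP[j _ ->]|_]; last exact: deg0 gra _ _.
    by rewrite abszN absz_nat; exact: deg_mono.
  by case: eqP => [->|_] //; exact: deg0 gra _ _.
have us : uniq s by exact: undup_uniq.
have inj : injective (fun j : nat => - j%:Z) by move=> i j /oppr_inj[].
have cs : \sum_(m <- s) c m = 0.
  rewrite sumrB; apply/eqP; rewrite subr_eq0; apply/eqP.
  rewrite -!big_mkcond /= -big_filter -[RHS]big_filter.
  have -> : \sum_(i <- [seq i <- s | i == n]) z = z.
    rewrite (perm_big [:: n]) ?big_seq1 //.
    apply: uniq_perm; rewrite ?filter_uniq // => m.
    by rewrite mem_filter mem_undup !inE; case: eqP.
  rewrite (perm_big [seq - j%:Z | j <- iota 0 N]).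
    rewrite big_map zE -(big_mkord xpredT y) /index_iota subn0.
    by apply: eq_bigr => j _; rewrite abszN absz_nat.
  apply: uniq_perm; rewrite ?filter_uniq ?map_inj_uniq ?iota_uniq // => m.
  by rewrite mem_filter mem_undup inE; case: (m \in map _ _); rewrite ?orbT.
have ns : n \in s by rewrite mem_undup mem_head.
have := deg_direct gra us cd cs ns; rewrite /c eqxx.
case: ifP => [/mapP[j _ ->]|_] /eqP; rewrite subr_eq0 => /eqP <-.
  by exists j; [rewrite abszN absz_nat|left].
by exists 0%N; [exact: mono0|right].
Qed.

(** Products of j sections of T_A have degree -j, never positive. This forces both the bracket of
    two sections of A and the value of any BV differential on A to vanish. *)
Lemma deg_gt0 n (U : opens X) (x : L U) : deg n x -> (0 < n)%R -> x = 0.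
Proof.
move=> dx n0; apply: ringSheaf_sep => p /(deg_loc_mono dx)[V [h [Vp [j _ nj]]]].
exists V, h; split=> //; rewrite rmorph0; case: nj => // nj.
by move: n0; rewrite nj; lia.
Qed.

Lemma homogeneous_ind (P : forall U : opens X, L U -> Prop) :
    local_pred P ->
    (forall (U : opens X) (x y : L U), P U x -> P U y -> P U (x + y)) ->
    (forall n (U : opens X) (x : L U), deg n x -> P U x) ->
  forall (U : opens X) (x : L U), P U x.
Proof.
move=> Pl PD Ph U x; apply: Pl => p Up.
have [V [h [s [c [Vp us cd xE]]]]] := deg_sum gra x Up.
exists V, h; split=> //; rewrite {}xE.
apply: big_ind => [|z w|n _]; [|exact: PD|exact: Ph (cd n)].
by apply: (Ph 0); exact: deg0 gra _ _.
Qed.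

End Exterior.

(** * The bracket *)

(** The sign automorphism s is induced by the identity of A and x |-> -x on T_A. It acts by (-1)^n
    on products of n sections of T_A, hence by the expected sign on every homogeneous section. *)
Lemma exterior_parity (k : fieldType) (X : scheme k) (A : DX_algebra X)
    (T : tangent_algebroid A) (L : exterior_algebra T)
    (deg : int -> forall U : opens X, L U -> Prop)
    (br : forall U : opens X, L U -> L U -> L U)
    (hL : polyvector_gerstenhaber deg br) :
  exists sg : forall U : opens X, {rmorphism L U -> L U},
    (forall (U V : opens X) (h : V `<=` U) (x : L U),
       sg V (rres h x) = rres h (sg U x)) /\
    (forall n (U : opens X) (x : L U), deg n U x -> sg U x = sgn n * x).
Proof.
have [q0 qc q1 ql qz] := ext_sq L.
pose j1 U : {additive T U -> L U} := -%R \o ext1 L U.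
have [|sg [sgr sg0 sg1 _]] := @ext_univ _ _ _ _ L _ (ext0 L) j1.
  split=> //.
  - by move=> U V h x; rewrite /= q1 rmorphN.
  - by move=> U a x; rewrite /= ql mulrN.
  - by move=> U x; rewrite /= mulrNN qz.
have sgm (U : opens X) n (x : L U) : mono n x -> sg U x = (-1) ^+ n * x.
  elim=> {n x} [n||n x y _ Hx _ Hy|n a x _ Hx|n y x _ Hx].
  - by rewrite rmorph0 mulr0.
  - by rewrite rmorph1 mul1r.
  - by rewrite rmorphD Hx Hy mulrDr.
  - by rewrite rmorphM Hx sg0 !mulrA -(qc _ a).
  - rewrite rmorphM Hx sg1 /= exprS -signr_odd; case: odd => /=.
      by rewrite !mulN1r opprK mulrNN mul1r.
    by rewrite mulr1 !mul1r mulN1r mulNr.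
exists sg; split=> // n U x dx; apply: ringSheaf_sep => p Up.
have [V [h [Vp [j mj nj]]]] := deg_loc_mono hL dx Up.
exists V, h; split=> //; rewrite -sgr (sgm _ _ _ mj) rmorphM.
case: nj => [->|->]; last by rewrite !mulr0.
by rewrite /sgn abszN absz_nat rmorph_sign.
Qed.

Section Bracket.
Variables (k : fieldType) (X : scheme k) (A : DX_algebra X).
Variables (T : tangent_algebroid A) (L : exterior_algebra T).
Variables (deg : int -> forall U : opens X, L U -> Prop).
Variable (br : forall U : opens X, L U -> L U -> L U).
Hypothesis hL : polyvector_gerstenhaber deg br.
Variable sg : forall U : opens X, {rmorphism L U -> L U}.
Hypothesis sg_res : forall (U V : opens X) (h : V `<=` U) (x : L U),
  sg V (rres h x) = rres h (sg U x).
Hypothesis sg_deg : forall n (U : opens X) (x : L U), deg n x ->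
  sg U x = sgn n * x.

Let ger := pv_ger hL.

Lemma br0l (U : opens X) (x : L U) : br 0 x = 0.
Proof. by apply: (addIr (br 0 x)); rewrite -(brDl ger) !add0r. Qed.

Lemma br0r (U : opens X) (x : L U) : br x 0 = 0.
Proof. by apply: (addIr (br x 0)); rewrite -(brDr ger) !add0r. Qed.

Lemma brNl (U : opens X) (x y : L U) : br (- x) y = - br x y.
Proof. by apply: (addIr (br x y)); rewrite -(brDl ger) !addNr br0l. Qed.

Lemma brNr (U : opens X) (x y : L U) : br x (- y) = - br x y.
Proof. by apply: (addIr (br x y)); rewrite -(brDr ger) !addNr br0r. Qed.

Lemma br_sgnl n (U : opens X) (x y : L U) : br (sgn n * x) y = sgn n * br x y.
Proof. by rewrite !sgnE; case: odd; rewrite ?mul1r // !expr1 !mulN1r brNl. Qed.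

Lemma br_resE (U V : opens X) (h : V `<=` U) (x y : L U) :
  rres h (br x y) = br (rres h x) (rres h y).
Proof. by rewrite (br_res ger). Qed.

Lemma rresD (U V : opens X) (h : V `<=` U) (x y : L U) :
  rres h (x + y) = rres h x + rres h y.
Proof. exact: rmorphD. Qed.

Lemma rresN (U V : opens X) (h : V `<=` U) (x : L U) :
  rres h (- x) = - rres h x.
Proof. exact: rmorphN. Qed.

Lemma rresM (U V : opens X) (h : V `<=` U) (x y : L U) :
  rres h (x * y) = rres h x * rres h y.
Proof. exact: rmorphM. Qed.

Lemma rres_sgn n (U V : opens X) (h : V `<=` U) :
  rres h (sgn n : L U) = sgn n.
Proof. exact: rmorph_sign. Qed.

Lemma sg_resE (U V : opens X) (h : V `<=` U) (x : L U) :
  rres h (sg U x) = sg V (rres h x).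
Proof. by rewrite sg_res. Qed.

Definition resE := (rresD, rresN, rresM, rres_sgn, br_resE, sg_resE,
  @ext0_res _ _ _ _ L, @ext1_res _ _ _ _ L).

(** The sign does not involve the degree of [c], so the rule extends from homogeneous [c] to all [c]
    by additivity and locality. The degrees of [a] and [b] survive restriction, which is why they
    are quantified inside [P]. *)
Lemma br_poisson_hom i j (U : opens X) (a b c : L U) :
  deg i a -> deg j b ->
  br a (b * c) = br a b * c + sgn ((i - 1) * j) * (b * br a c).
Proof.
pose P (U : opens X) c := forall i j (a b : L U), deg i a -> deg j b ->
  br a (b * c) = br a b * c + sgn ((i - 1) * j) * (b * br a c).
suff Pc : P U c by exact: Pc.
move: U c {i j a b}; apply: (homogeneous_ind hL (P := P)).
- move=> U c H i j a b da db; apply: ringSheaf_sep => p /H[V [h [Vp Hc]]].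
  exists V, h; split=> //; rewrite !resE; apply: Hc.
    exact: (deg_res (ger_graded ger)).
  exact: (deg_res (ger_graded ger)).
- move=> U x y Hx Hy i j a b da db.
  rewrite mulrDr !(brDr ger) (Hx i j) // (Hy i j) //.
  by rewrite !mulrDr addrACA.
- by move=> n U c dc i j a b da db; exact: (br_poisson ger da db dc).
Qed.

Lemma br_jacobi_hom i j (U : opens X) (a b c : L U) :
  deg i a -> deg j b ->
  br a (br b c) = br (br a b) c + sgn ((i - 1) * (j - 1)) * br b (br a c).
Proof.
pose P (U : opens X) c := forall i j (a b : L U), deg i a -> deg j b ->
  br a (br b c) = br (br a b) c + sgn ((i - 1) * (j - 1)) * br b (br a c).
suff Pc : P U c by exact: Pc.
move: U c {i j a b}; apply: (homogeneous_ind hL (P := P)).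
- move=> U c H i j a b da db; apply: ringSheaf_sep => p /H[V [h [Vp Hc]]].
  exists V, h; split=> //; rewrite !resE; apply: Hc.
    exact: (deg_res (ger_graded ger)).
  exact: (deg_res (ger_graded ger)).
- move=> U x y Hx Hy i j a b da db.
  rewrite !(brDr ger) (Hx i j) // (Hy i j) //.
  by rewrite !mulrDr addrACA.
- by move=> n U c dc i j a b da db; exact: (br_jacobi ger da db dc).
Qed.

(** For homogeneous sections this combines the Poisson rules in the two arguments of the bracket;
    the general case follows since all terms are additive in each variable and compatible with
    restriction. *)
Lemma br_sg_cocycle (U : opens X) (a b c : L U) :
  br (sg U a) b * c + br (sg U (a * b)) c
  = sg U a * br (sg U b) c + br (sg U a) (b * c).
Proof.
pose C (U : opens X) (a b c : L U) := br (sg U a) b * c + br (sg U (a * b)) c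
  = sg U a * br (sg U b) c + br (sg U a) (b * c).
have gra := ger_graded ger.
have Chom i j l V (x y z : L V) : deg i x -> deg j y -> deg l z -> C V x y z.
  move=> dx dy dz.
  rewrite /C (sg_deg dx) (sg_deg dy) (sg_deg (degM gra dx dy)) !br_sgnl.
  (* The Poisson rule is given in the second argument only, so [ab, c] is first turned into [c, ab].
     After expansion [c, a] and [c, b] are turned back, and graded commutativity moves [a, c] past
     b. *)
  rewrite (br_anti ger (degM gra dx dy) dz) (br_poisson ger dz dx dy).
  rewrite (br_poisson ger dx dy dz) (br_anti ger dz dx) (br_anti ger dz dy).
  have := ger_comm ger (br_deg ger dx dz) dy.
  rewrite !(sgnE, odd_abszM, odd_abszD) /=.
  case: (odd `|i|); case: (odd `|j|); case: (odd `|l|); rewrite /=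
    !(expr0, expr1, mul1r, mulN1r, mulrN, mulNr, opprK, opprD, mulrDl, mulrA)
    => ->;
    by rewrite ?opprK addrA [LHS]addrC.
have Cl V (x y z : L V) : (forall p, oset V p ->
    exists (W : opens X) (h : W `<=` V), oset W p /\
    C W (rres h x) (rres h y) (rres h z)) -> C V x y z.
  move=> H; apply: ringSheaf_sep => p /H[W [h [Wp HW]]].
  by exists W, h; split=> //; rewrite !resE; exact: HW.
have distr := (rmorphD, mulrDl, mulrDr, brDl ger, brDr ger).
(* The variables are made homogeneous one after the other, in the order [b], [a], [c]. *)
move: U b a c; apply: (homogeneous_ind hL
  (P := fun U b => forall a c, C U a b c)).
- move=> U b H a c; apply: Cl => p /H[V [h [Vp HV]]].
  by exists V, h; split.
- move=> U b b' Cb Cb' a c; rewrite /C !distr [LHS]addrACA [RHS]addrACA.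
  by rewrite Cb Cb'.
move=> j U b db a; move: U a b db.
apply: (homogeneous_ind hL
  (P := fun U a => forall b, deg j b -> forall c, C U a b c)).
- move=> U a H b db c; apply: Cl => p /H[V [h [Vp HV]]].
  by exists V, h; split=> //; apply: HV; exact: (deg_res gra).
- move=> U a a' Ca Ca' b db c; rewrite /C !distr [LHS]addrACA [RHS]addrACA.
  by rewrite Ca ?Ca'.
move=> i U a da b db c; move: U c a b da db.
apply: (homogeneous_ind hL
  (P := fun U c => forall a b, deg i a -> deg j b -> C U a b c)).
- move=> U c H a b da db; apply: Cl => p /H[V [h [Vp HV]]].
  by exists V, h; split=> //; apply: HV; exact: (deg_res gra).
- move=> U c c' Cc Cc' a b da db; rewrite /C !distr [LHS]addrACA [RHS]addrACA.
  by rewrite Cc ?Cc'.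
by move=> l U c dc a b da db; exact: Chom da db dc.
Qed.

Lemma br_ext00 (U : opens X) (a b : A U) : br (ext0 L U a) (ext0 L U b) = 0.
Proof.
have d0 (c : A U) := pv_deg0 hL c.
by apply: (deg_gt0 hL (br_deg ger (d0 a) (d0 b))); lia.
Qed.

Lemma br_ext01 (U : opens X) (a : A U) (x : T U) :
  br (ext0 L U a) (ext1 L U x) = - ext0 L U (anchor x a).
Proof.
rewrite (br_anti ger (pv_deg0 hL a) (pv_deg1 hL x)) (pv_anchor hL).
by rewrite sgnE mul1r.
Qed.

(** For |a| = 0 the antisymmetry sign is (-1)^|x|, which s cancels. This is the symmetry that makes
    (a, 0) central in the deformed ring. *)
Lemma br_ext0r (U : opens X) (a : A U) (x : L U) :
  br (sg U x) (ext0 L U a) = br (ext0 L U a) x.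
Proof.
move: U x a; apply: (homogeneous_ind hL (P := fun U x =>
  forall a, br (sg U x) (ext0 L U a) = br (ext0 L U a) x)).
- move=> U x H a; apply: ringSheaf_sep => p /H[V [h [Vp HV]]].
  by exists V, h; split=> //; rewrite !resE; exact: HV.
- by move=> U x y Hx Hy a; rewrite rmorphD (brDl ger) (brDr ger) Hx Hy.
- move=> n U x dx a; rewrite (sg_deg dx) br_sgnl.
  rewrite (br_anti ger dx (pv_deg0 hL a)) !(sgnE, odd_abszM, odd_abszD) /=.
  by case: (odd _); rewrite /= !(expr0, expr1, mul1r, mulN1r, opprK).
Qed.

Lemma br_mul00 (U : opens X) (a b : A U) (c : L U) :
  br (ext0 L U a) (ext0 L U b * c) = ext0 L U b * br (ext0 L U a) c.
Proof.
rewrite (br_poisson_hom _ (pv_deg0 hL a) (pv_deg0 hL b)) br_ext00 mul0r add0r.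
by rewrite sgnE mul1r.
Qed.

Lemma br_mul01 (U : opens X) (a : A U) (x : T U) (c : L U) :
  br (ext0 L U a) (ext1 L U x * c) =
  - (ext0 L U (anchor x a) * c) - ext1 L U x * br (ext0 L U a) c.
Proof.
rewrite (br_poisson_hom _ (pv_deg0 hL a) (pv_deg1 hL x)) br_ext01.
by rewrite sgnE mulN1r mulNr.
Qed.

Lemma br_mul10 (U : opens X) (x : T U) (a : A U) (c : L U) :
  br (ext1 L U x) (ext0 L U a * c) =
  ext0 L U (anchor x a) * c + ext0 L U a * br (ext1 L U x) c.
Proof.
rewrite (br_poisson_hom _ (pv_deg1 hL x) (pv_deg0 hL a)) (pv_anchor hL).
by rewrite sgnE mul1r.
Qed.

Lemma br_mul11 (U : opens X) (x y : T U) (c : L U) :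
  br (ext1 L U x) (ext1 L U y * c) =
  ext1 L U (lie x y) * c + ext1 L U y * br (ext1 L U x) c.
Proof.
rewrite (br_poisson_hom _ (pv_deg1 hL x) (pv_deg1 hL y)) (pv_lie hL).
by rewrite sgnE mul1r.
Qed.

Lemma br_jacobi00 (U : opens X) (a b : A U) (c : L U) :
  br (ext0 L U a) (br (ext0 L U b) c) = - br (ext0 L U b) (br (ext0 L U a) c).
Proof.
rewrite (br_jacobi_hom _ (pv_deg0 hL a) (pv_deg0 hL b)) br_ext00 br0l add0r.
by rewrite sgnE mulN1r.
Qed.

Lemma br_jacobi10 (U : opens X) (x : T U) (a : A U) (c : L U) :
  br (ext1 L U x) (br (ext0 L U a) c) =
  br (ext0 L U (anchor x a)) c + br (ext0 L U a) (br (ext1 L U x) c).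
Proof.
rewrite (br_jacobi_hom _ (pv_deg1 hL x) (pv_deg0 hL a)) (pv_anchor hL).
by rewrite sgnE mul1r.
Qed.

Lemma br_jacobi11 (U : opens X) (x y : T U) (c : L U) :
  br (ext1 L U x) (br (ext1 L U y) c) =
  br (ext1 L U (lie x y)) c + br (ext1 L U y) (br (ext1 L U x) c).
Proof.
rewrite (br_jacobi_hom _ (pv_deg1 hL x) (pv_deg1 hL y)) (pv_lie hL).
by rewrite sgnE mul1r.
Qed.

(** Expanding [x, 1 * 1] by the Poisson rule gives [x, 1] = [x, 1] + [x, 1]. *)
Lemma br1r (U : opens X) (x : L U) : br x 1 = 0.
Proof.
move: U x; apply: (homogeneous_ind hL (P := fun U x => br x 1 = 0)).
- move=> U x H; apply: ringSheaf_sep => p /H[V [h' [Vp HV]]].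
  by exists V, h'; split=> //; rewrite !resE rmorph1 rmorph0.
- by move=> U x y Hx Hy; rewrite (brDl ger) Hx Hy addr0.
- move=> n U x dx; have d1 : deg 0 (1 : L U).
    by rewrite -(rmorph1 (ext0 L U)); exact: (pv_deg0 hL).
  have := br_poisson_hom 1 dx d1; rewrite !mulr1 mulr0 sgnE mul1r mul1r.
  by move=> /eqP; rewrite -subr_eq0 opprD addNKr oppr_eq0 => /eqP.
Qed.

Lemma br1l (U : opens X) (x : L U) : br 1 x = 0.
Proof.
by rewrite -(rmorph1 (ext0 L U)) -br_ext0r rmorph1 br1r.
Qed.

End Bracket.

Lemma comRingSheaf_sep (X : topologicalType) (G : comRingSheaf X) (U : opens X)
    (x y : G U) :
  (forall p, oset U p -> exists (V : opens X) (h : V `<=` U),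
     oset V p /\ cres h x = cres h y) -> x = y.
Proof. exact: (sheaf_sep (@cres_comp _ G) (@csec_sheaf _ G)). Qed.

(** * The right connection *)

Section RightAction.
Variables (k : fieldType) (X : scheme k) (A : DX_algebra X).
Variables (T : tangent_algebroid A).

(** Stability of [P] under restriction is not assumed. The auxiliary [Q], which asks for [P] on all
    restrictions, is a subgroup sheaf to which induction on generators applies. *)
Lemma tangent_rec (P : forall U : opens X, T U -> Prop) :
    (forall (U : opens X) (x : T U), (forall p, oset U p ->
      exists (V : opens X) (h : V `<=` U), oset V p /\ P V (mres h x)) ->
      P U x) ->
    (forall (U : opens X) (x y : T U), P U x -> P U y -> P U (x - y)) ->
    (forall (U : opens X) (a : A U) (t : vfield U), P U (tens T a t)) ->
  forall (U : opens X) (x : T U), P U x.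
Proof.
move=> Pl PB Pt U x.
pose Q (U : opens X) (x : T U) :=
  forall (V : opens X) (h : V `<=` U), P V (mres h x).
suff Qx : Q U x by rewrite -(mres_id (@subset_refl _ U) x); exact: Qx.
have Q0 V : Q V 0.
  by move=> W h; rewrite raddf0 -(subrr (tens T 0 0)); exact: PB.
have QB V (y z : T V) : Q V y -> Q V z -> Q V (y - z).
  by move=> Qy Qz W h; rewrite raddfB; apply: PB; [exact: Qy|exact: Qz].
have Qr (V W : opens X) (h : W `<=` V) (y : T V) : Q V y -> Q W (mres h y).
  move=> Qy W' h'; rewrite (mres_comp _ _ (subset_trans h' h)); exact: Qy.
have Ql (V : opens X) (y : T V) : (forall p, oset V p -> exists (W : opens X)
    (h : W `<=` V), oset W p /\ Q W (mres h y)) -> Q V y.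
  move=> H W h; apply: Pl => p Wp; have [W' [h' [Wp' HQ]]] := H p (h _ Wp).
  exists (opensI W W'), (@opensIl _ W W'); split=> //.
  have hI : opensI W W' `<=` V := subset_trans (@opensIl _ W W') h.
  by rewrite (mres_comp _ _ hI) -(mres_comp h' (@opensIr _ W W')); exact: HQ.
apply: (tangent_ind (S := @SubgroupSheaf _ (mod_abSheaf T) Q Q0 QB Qr Ql)).
move=> V a t W h; have [_ _ _ <-] := tens_balanced T; exact: Pt.
Qed.

Lemma anchorB (U : opens X) (x y : T U) (a : A U) :
  anchor (x - y) a = anchor x a - anchor y a.
Proof. by apply: (addIr (anchor y a)); rewrite -anchorD !subrK. Qed.

Lemma lieBl (U : opens X) (x y z : T U) : lie (x - y) z = lie x z - lie y z.
Proof. by apply: (addIr (lie y z)); rewrite -lieDl !subrK. Qed.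

Lemma lieBr (U : opens X) (x y z : T U) : lie x (y - z) = lie x y - lie x z.
Proof. by apply: (addIr (lie x z)); rewrite -lieDr !subrK. Qed.

Variables (D : DA_sheaf A) (C : CY_structure D).
Variable nabla : forall U : opens X, {additive T U -> A U}.
Hypothesis hnabla : associated_map C nabla.

Let resn := nabla_res hnabla.

Lemma ractBr (U : opens X) (a : A U) (P Q : D U) :
  ract C a (P - Q) = ract C a P - ract C a Q.
Proof. by apply: (addIr (ract C a Q)); rewrite -ractDr !subrK. Qed.

(** This is the relation ta - at = t(a) of D_A, applied to 1 from the right. *)
Lemma ract1_commutator (U : opens X) (t : vfield U) (a : A U) :
  dact t a = ract C 1 (genT D U t) * a - ract C a (genT D U t).
Proof.
rewrite -[LHS]mul1r -(ractA C) -(rel_TA (DA_rel D)) ractBr !ractM !ractA.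
by rewrite mul1r.
Qed.

(** Additivity is read off from the right action, because [dactDr] would first require a proof that
    [t] satisfies [diffop]. *)
Lemma dactB (U : opens X) (t : vfield U) (a b : A U) :
  dact t (a - b) = dact t a - dact t b.
Proof.
have ractB c d : ract C (c - d) (genT D U t) =
    ract C c (genT D U t) - ract C d (genT D U t).
  by apply: (addIr (ract C d (genT D U t))); rewrite -ractDl !subrK.
rewrite !ract1_commutator ractB.
move: (ract C 1 _) (ract C a _) (ract C b _) => n u v; ring.
Qed.

(** A normal form: the right action of [t] is determined by its divergence 1 . t and the derivation
    [t]. *)
Lemma ract_genT (U : opens X) (t : vfield U) (a : A U) :
  ract C a (genT D U t) = a * ract C 1 (genT D U t) - dact t a.
Proof. by rewrite ract1_commutator mulrC opprB addrCA subrr addr0. Qed.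

(** On a generator [tens T b t] both sides are brought to normal form, where the claim is the
    Leibniz rule for t(ab). *)
Lemma nablaZ (U : opens X) (a : A U) (x : T U) :
  nabla U (a *: x) = a * nabla U x - anchor x a.
Proof.
move: U x a; apply: (tangent_rec (P := fun U x => forall a,
  nabla U (a *: x) = a * nabla U x - anchor x a)).
- move=> U x H a; apply: comRingSheaf_sep => p /H[V [h [Vp HV]]].
  exists V, h; split=> //.
  by rewrite rmorphB rmorphM -!resn -anchor_res mres_scale HV.
- move=> U x y Hx Hy a; rewrite scalerBr anchorB !raddfB /= Hx Hy mulrBr.
  by move: (nabla U x) (nabla U y) (anchor x a) (anchor y a) => u v c d; ring.
- move=> U b t a; rewrite tens_scale !(nabla_tens hnabla) anchor_tens.
  rewrite (ract_genT _ (a * b)) (ract_genT _ b).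
  rewrite dact_leibniz; move: (ract C 1 _) (dact t a) (dact t b) => n c d; ring.
Qed.

Lemma dactD (U : opens X) (t : vfield U) (a b : A U) :
  dact t (a + b) = dact t a + dact t b.
Proof. by apply: (addIr (- dact t b)); rewrite -dactB !addrK. Qed.

Lemma anchorBr (U : opens X) (x : T U) (a b : A U) :
  anchor x (a - b) = anchor x a - anchor x b.
Proof.
move: U x a b; apply: (tangent_rec (P := fun U x => forall a b,
  anchor x (a - b) = anchor x a - anchor x b)).
- move=> U x H a b; apply: comRingSheaf_sep => p /H[V [h [Vp HV]]].
  by exists V, h; split=> //; rewrite rmorphB -!anchor_res rmorphB HV.
- move=> U x y Hx Hy a b; rewrite !anchorB Hx Hy.
  move: (anchor x a) (anchor x b) (anchor y a) (anchor y b) => u v c d; ring.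
- by move=> U c t a b; rewrite !anchor_tens dactB mulrBr.
Qed.

(** Flatness expresses the relation tu - ut = [t, u] in D_A. Locality and additivity in each
    argument reduce it to generators. *)
Lemma nabla_flat (U : opens X) (x y : T U) :
  nabla U (lie x y) = anchor x (nabla U y) - anchor y (nabla U x).
Proof.
move: U x y; apply: (tangent_rec (P := fun U x => forall y,
  nabla U (lie x y) = anchor x (nabla U y) - anchor y (nabla U x))).
- move=> U x H y; apply: comRingSheaf_sep => p /H[V [h [Vp HV]]].
  exists V, h; split=> //.
  by rewrite rmorphB -resn -!anchor_res -lie_res -!resn HV.
- move=> U x x' Hx Hx' y; rewrite lieBl anchorB !(raddfB (nabla U)) /=.
  rewrite Hx Hx' anchorBr.
  by rewrite !opprD [LHS]addrACA.
move=> U a t y; move: U y a t; apply: (tangent_rec (P := fun U y => forall a t,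
  nabla U (lie (tens T a t) y) =
  anchor (tens T a t) (nabla U y) - anchor y (nabla U (tens T a t)))).
- move=> U y H a t; apply: comRingSheaf_sep => p /H[V [h [Vp HV]]].
  exists V, h; split=> //.
  have [_ _ _ tr] := tens_balanced T.
  by rewrite rmorphB -resn -!anchor_res -lie_res -!resn -!tr HV.
- move=> U y y' Hy Hy' a t; rewrite lieBr anchorB !(raddfB (nabla U)) /=.
  rewrite Hy Hy' anchorBr.
  by rewrite !opprD [LHS]addrACA.
move=> U b u a t; rewrite lie_tens !anchor_tens raddfD raddfB /=.
rewrite !(nabla_tens hnabla).
rewrite -(rel_TT (DA_rel D)) ractBr !ractM.
rewrite (ract_genT t (a * b)) (ract_genT u (a * b)).
rewrite (ract_genT _ a) (ract_genT _ b).
rewrite (ract_genT u (a * _)) (ract_genT t (b * _)).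
rewrite (ract_genT u (_ - _)) (ract_genT t (_ - _)).
rewrite !(dactB, dactD, dact_leibniz).
(* In normal form only divergences and first and second derivatives remain; treated as independent
   variables, they satisfy a polynomial identity. *)
move: (ract C 1 (genT D U t)) (ract C 1 (genT D U u)) => nt nu.
move: (dact t (dact u a)) (dact t (dact u b)) (dact u (dact t a))
  (dact u (dact t b)) (dact t nu) (dact u nt) (dact t a) (dact t b)
  (dact u a) (dact u b) => *.
ring.
Qed.

End RightAction.

(** * The differential *)

Section Differential.
Variables (k : fieldType) (char0 : [pchar k] =i pred0).
Variables (X : scheme k) (A : DX_algebra X).
Variables (T : tangent_algebroid A) (L : exterior_algebra T).
Variables (deg : int -> forall U : opens X, L U -> Prop).
Variable (br : forall U : opens X, L U -> L U -> L U).
Hypothesis hL : polyvector_gerstenhaber deg br.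
Variable sg : forall U : opens X, {rmorphism L U -> L U}.
Hypothesis sg_res : forall (U V : opens X) (h : V `<=` U) (x : L U),
  sg V (rres h x) = rres h (sg U x).
Hypothesis sg_deg : forall n (U : opens X) (x : L U), deg n x ->
  sg U x = sgn n * x.
Variable nabla : forall U : opens X, {additive T U -> A U}.
Hypothesis nabla_res : forall (U V : opens X) (h : V `<=` U) (x : T U),
  nabla V (mres h x) = cres h (nabla U x).
Hypothesis nablaZ : forall (U : opens X) (a : A U) (x : T U),
  nabla U (a *: x) = a * nabla U x - anchor x a.
Hypothesis nabla_flat : forall (U : opens X) (x y : T U),
  nabla U (lie x y) = anchor x (nabla U y) - anchor y (nabla U x).

Let ger := pv_ger hL.

Lemma sg_ext0 (U : opens X) (a : A U) : sg U (ext0 L U a) = ext0 L U a.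
Proof. by rewrite (sg_deg (pv_deg0 hL a)) sgnE mul1r. Qed.

Lemma sg_ext1 (U : opens X) (x : T U) : sg U (ext1 L U x) = - ext1 L U x.
Proof. by rewrite (sg_deg (pv_deg1 hL x)) sgnE mulN1r. Qed.

(** In the shifted degree x is even, so the bracket is antisymmetric and 2[x, x] = 0; characteristic
    0 makes 2 invertible. *)
Lemma br_ext11_diag (U : opens X) (x : T U) : br (ext1 L U x) (ext1 L U x) = 0.
Proof.
set y := br _ _.
have y2 : y + y = 0.
  rewrite {1}/y (br_anti ger (pv_deg1 hL x) (pv_deg1 hL x)) sgnE mul1r.
  exact: addNr.
have two : 2%:R != 0 :> k.
  by have := char0 2%N; rewrite !inE /= => /negbT.
have y20 : ext_kst L U 2%:R * y = 0 by rewrite rmorph_nat mulr_natl mulr2n.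
rewrite -(mul1r y) -(rmorph1 (ext_kst L U)) -(mulVf two) rmorphM -mulrA.
by rewrite y20 mulr0.
Qed.

Definition bv_twist : twist L.
Proof.
exists sg (fun U a b => br (sg U a) b) => //.
- by move=> U V h a b; rewrite sg_res (br_res ger).
- by move=> U a a' b; rewrite rmorphD (brDl ger).
- by move=> U a b b'; rewrite (brDr ger).
- by move=> U a; rewrite rmorph1 (br1l hL sg_res sg_deg).
- by move=> U a; rewrite (br1r hL).
- exact: (br_sg_cocycle hL sg_res sg_deg).
Defined.

Lemma bv_operator_exists : exists d : forall U : opens X, {additive L U -> L U},
  [/\ forall (U V : opens X) (h : V `<=` U) (x : L U),
        d V (rres h x) = rres h (d U x),
      forall (U : opens X) (a : A U), d U (ext0 L U a) = 0,
      forall (U : opens X) (x : T U), d U (ext1 L U x) = ext0 L U (nabla U x) &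
      forall (U : opens X) (x y : L U),
        d U (x * y) = d U x * y + sg U x * d U y + br (sg U x) y].
Proof.
have [q0 qc q1 ql qz] := ext_sq L.
pose f0 U (a : A U) : tws bv_twist U := (ext0 L U a, 0).
pose f1 U (x : T U) : tws bv_twist U := (ext1 L U x, ext0 L U (nabla U x)).
have f0a U : zmod_morphism (@f0 U).
  by move=> a b; congr pair; rewrite /= ?rmorphB ?subr0.
have f0m U : monoid_morphism (@f0 U).
  split=> [|a b]; congr pair; rewrite /= ?rmorph1 ?rmorphM //.
  by rewrite mul0r mulr0 sg_ext0 (br_ext00 hL) !addr0.
have f1a U : zmod_morphism (@f1 U).
  by move=> a b; congr pair; rewrite /= ?raddfB.
pose j0 V : {rmorphism A V -> tws bv_twist V} := HB.pack (@f0 V)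
  (GRing.isZmodMorphism.Build _ _ _ (f0a V))
  (GRing.isMonoidMorphism.Build _ _ _ (f0m V)).
pose j1 V : {additive T V -> tws bv_twist V} := HB.pack (@f1 V)
  (GRing.isZmodMorphism.Build _ _ _ (f1a V)).
have [|phi [phir phi0 phi1 _]] :=
    @ext_univ _ _ _ _ L (twisted_ring bv_twist) j0 j1.
  split.
  - by move=> U V h a; congr pair; rewrite /= ?rmorph0 // -q0.
  (* In the second component, centrality of (a, 0) is the identity [a, x] = [s(x), a]. *)
  - move=> U a [x u]; congr pair; rewrite /= ?qc //.
    rewrite mul0r mulr0 sg_ext0 add0r addr0 qc; congr (_ + _).
    by rewrite (br_ext0r hL sg_res sg_deg).
  - by move=> U V h x; congr pair; rewrite /= ?nabla_res ?q0 ?q1.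
  (* A-linearity of x |-> (x, nabla x) amounts to nabla(ax) = a nabla(x) + [a, x], where [a, x] =
     -x(a). *)
  - move=> U a x; congr pair; rewrite /= ?ql //.
    rewrite mul0r add0r sg_ext0 nablaZ rmorphB rmorphM.
    by rewrite (br_ext01 hL).
  (* The second component of the square is nabla(x) x - x nabla(x) - [x, x]; A is central and the
     bracket vanishes. *)
  - move=> U x; congr pair; rewrite /= ?qz //.
    rewrite sg_ext1 (brNl hL) br_ext11_diag oppr0 addr0 qc mulNr.
    exact: subrr.
(* The first projection after [phi] fixes A and T_A, so by uniqueness it is the identity. Hence
   [phi] splits the projection, and its second component is the operator sought. *)
have fst_id U (x : L U) : (phi U x).1 = x.
  have [psi [_ _ _ psi_uniq]] := @ext_univ _ _ _ _ L _ _ _ (ext_sq L).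
  pose v V : {rmorphism twisted_ring bv_twist V -> L V} :=
    @tws_fst _ _ bv_twist V.
  have e1 := psi_uniq (fun U => idfun : {rmorphism L U -> L U}).
  have e2 := psi_uniq (fun U => v U \o phi U : {rmorphism L U -> L U}).
  rewrite [RHS]e1 // -e2 // => [V W h y|V a|V a] /=.
  - by rewrite phir.
  - by rewrite phi0.
  - by rewrite phi1.
have da U : zmod_morphism (fun x => (phi U x).2).
  by move=> x y; rewrite rmorphB.
pose d V : {additive L V -> L V} := HB.pack (fun x => (phi V x).2)
  (GRing.isZmodMorphism.Build _ _ _ (da V)).
exists d; split=> /=.
- by move=> U V h x; rewrite phir.
- by move=> U a; rewrite phi0.
- by move=> U x; rewrite phi1.
- by move=> U x y; rewrite rmorphM /= !fst_id.
Qed.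

Variable d : forall U : opens X, {additive L U -> L U}.
Hypothesis dr : forall (U V : opens X) (h : V `<=` U) (x : L U),
  d V (rres h x) = rres h (d U x).
Hypothesis d0 : forall (U : opens X) (a : A U), d U (ext0 L U a) = 0.
Hypothesis d1 : forall (U : opens X) (x : T U),
  d U (ext1 L U x) = ext0 L U (nabla U x).
Hypothesis dM : forall (U : opens X) (x y : L U),
  d U (x * y) = d U x * y + sg U x * d U y + br (sg U x) y.

Lemma bv_mul0 (U : opens X) (a : A U) (c : L U) :
  d U (ext0 L U a * c) = ext0 L U a * d U c + br (ext0 L U a) c.
Proof. by rewrite dM d0 sg_ext0 mul0r add0r. Qed.

Lemma bv_mul1 (U : opens X) (x : T U) (c : L U) :
  d U (ext1 L U x * c)
  = ext0 L U (nabla U x) * c - ext1 L U x * d U c - br (ext1 L U x) c.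
Proof. by rewrite dM d1 sg_ext1 mulNr (brNl hL). Qed.

Lemma bv_one (U : opens X) : d U 1 = 0.
Proof. by rewrite -(rmorph1 (ext0 L U)) d0. Qed.

Lemma bv_br0 (U : opens X) (a : A U) (c : L U) :
  d U (br (ext0 L U a) c) = - br (ext0 L U a) (d U c).
Proof.
move: U c a; apply: (ext_rec (P := fun U c => forall a,
  d U (br (ext0 L U a) c) = - br (ext0 L U a) (d U c))).
- move=> U c H a; apply: ringSheaf_sep => p /H[V [h [Vp HV]]].
  exists V, h; split=> //.
  by rewrite rmorphN (br_resE hL) -!dr (br_resE hL) ext0_res HV.
- by move=> U x y Hx Hy a; rewrite !(raddfD (d U), brDr ger) Hx Hy opprD.
- by move=> U a; rewrite (br1r hL) bv_one (br0r hL) oppr0 raddf0.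
- move=> U b c Hc a.
  rewrite (br_mul00 hL) !bv_mul0 Hc (brDr ger) (br_mul00 hL) (br_jacobi00 hL).
  by rewrite mulrN opprD.
- move=> U y c Hc a.
  rewrite (br_mul01 hL) raddfB raddfN /= bv_mul0 !bv_mul1 Hc.
  rewrite !(brDr ger) !(brNr hL) (br_mul00 hL) (br_mul01 hL) (br_jacobi10 hL).
  rewrite mulrN opprK !opprD !opprK.
  (* The two terms [y(a), c] cancel: one comes from d(y(a) c), the other from the Jacobi identity
     for [y, [a, c]]. *)
  rewrite [LHS](AC (2*(2*2)) (((3*(1*4))*6)*(2*5)))/=.
  by rewrite addNr addr0.
Qed.

Lemma bv_br1 (U : opens X) (x : T U) (c : L U) :
  d U (br (ext1 L U x) c) =
  br (ext0 L U (nabla U x)) c + br (ext1 L U x) (d U c).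
Proof.
move: U c x; apply: (ext_rec (P := fun U c => forall x,
  d U (br (ext1 L U x) c) =
  br (ext0 L U (nabla U x)) c + br (ext1 L U x) (d U c))).
- move=> U c H x; apply: ringSheaf_sep => p /H[V [h [Vp HV]]].
  exists V, h; split=> //.
  rewrite rmorphD !(br_resE hL) -!dr (br_resE hL) ext0_res ext1_res.
  by rewrite -nabla_res HV.
- by move=> U y z Hy Hz x; rewrite !(raddfD (d U), brDr ger) Hy Hz addrACA.
- by move=> U a; rewrite !(br1r hL) bv_one (br0r hL) addr0 raddf0.
- move=> U b c Hc x.
  rewrite (br_mul10 hL) raddfD /= !bv_mul0 Hc !(brDr ger).
  rewrite (br_mul10 hL) (br_mul00 hL) (br_jacobi10 hL).
  rewrite !mulrDr.
  by rewrite [LHS](AC (2*3) (3*((1*4)*(2*5)))).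
- move=> U y c Hc x.
  rewrite (br_mul11 hL) raddfD /= !bv_mul1 Hc !(brDr ger) !(brNr hL).
  rewrite (br_mul10 hL) (br_mul11 hL) (br_mul01 hL) (br_jacobi11 hL x y).
  (* On the left the coefficient of c is nabla[x, y]; on the right it is x(nabla y) - y(nabla x), so
     flatness is what matches them. *)
  rewrite nabla_flat rmorphB !mulrBl !mulrDr !opprD.
  by rewrite [LHS](AC (4*(1*2*1)) ((2*6)*((1*5)*(3*7)*(4*8)))).
Qed.

Lemma bv_square (U : opens X) (x : L U) : d U (d U x) = 0.
Proof.
move: U x; apply: (ext_rec (P := fun U x => d U (d U x) = 0)).
- move=> U x H; apply: ringSheaf_sep => p /H[V [h [Vp HV]]].
  by exists V, h; split=> //; rewrite -!dr HV rmorph0.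
- by move=> U x y Hx Hy; rewrite !raddfD /= Hx Hy addr0.
- by move=> U; rewrite bv_one raddf0.
- move=> U a c Hc; rewrite bv_mul0 raddfD /= bv_mul0 Hc bv_br0.
  by rewrite mulr0 add0r subrr.
- move=> U y c Hc; rewrite bv_mul1 !raddfB /= bv_mul0 bv_mul1 Hc bv_br1.
  rewrite mulr0 subr0 opprB !opprD.
  (* Three pairs cancel: nabla(y) dc, [nabla y, c] and [y, dc]. *)
  by rewrite [LHS](AC (2*2*2) ((1*4)*(2*5)*(3*6)))/= !subrr !addr0.
Qed.

(** Degree is a local condition, so it can be checked on products, by induction on their
    construction and the formulas for d(ac) and d(xc). *)
Lemma bv_deg n (U : opens X) (x : L U) : deg n x -> deg (n + 1) (d U x).
Proof.
have gra := ger_graded ger.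
have dm (V : opens X) j (y : L V) : mono j y -> deg (- j%:Z + 1) (d V y).
  elim=> {j y} [j||j y z _ Hy _ Hz|j a y my Hy|j z y my Hy].
  - by rewrite raddf0; exact: (deg0 gra).
  - by rewrite bv_one; exact: (deg0 gra).
  - by rewrite raddfD; exact: (deg_add hL).
  - rewrite bv_mul0; apply: (deg_add hL).
      by rewrite -[- _ + 1]add0r; apply: (degM gra) => //; exact: (pv_deg0 hL).
    by have := br_deg ger (pv_deg0 hL a) (deg_mono hL my); rewrite add0r.
  - have e : - j%:Z = - j.+1%:Z + 1 by lia.
    have dy := deg_mono hL my.
    rewrite bv_mul1 -e; apply: (degB gra); first apply: (degB gra).
    + by rewrite -[- _]add0r; apply: (degM gra) => //; exact: (pv_deg0 hL).
    + have -> : - j%:Z = -1 + (- j%:Z + 1) by lia.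
      by apply: (degM gra) => //; exact: (pv_deg1 hL).
    + have -> : - j%:Z = -1 + (- j%:Z) + 1 by lia.
      by apply: (br_deg ger) => //; exact: (pv_deg1 hL).
move=> dx; apply: (deg_loc gra) => p Up.
have [V [h [Vp [j mj nj]]]] := deg_loc_mono hL dx Up.
exists V, h; split=> //; rewrite -dr; case: nj => [->|->]; first exact: dm.
by rewrite raddf0; exact: (deg0 gra).
Qed.

Lemma bv_structure : batalin_vilkovisky (ext_kst L) deg br (fun U => d U).
Proof.
split=> //; first split=> //.
- by move=> U a b; exact: raddfD.
- move=> U c a; rewrite bv_mul0 /=.
  (* Linearity over k needs [c, a] = 0 for constants c, which holds since [c, a] = c[1, a] and
     [1, a] = 0. *)
  have := brZl ger c 1 a; rewrite mulr1 => ->.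
  by rewrite (br1l hL sg_res sg_deg) mulr0 addr0.
- exact: bv_deg.
- exact: bv_square.
move=> i j U a b da db; rewrite dM (sg_deg da) (br_sgnl hL) mulrA.
by rewrite [X in X - _ - _]addrC addrA addrAC !addrK.
Qed.

(** The BV identity for [d'] holds on homogeneous sections, so the comparison is made on products of
    a fixed length, where a left factor from A or T_A determines the value recursively. *)
Lemma bv_unique (d' : forall U : opens X, L U -> L U) :
  batalin_vilkovisky (ext_kst L) deg br d' ->
  (forall (U : opens X) (x : T U), d' U (ext1 L U x) = ext0 L U (nabla U x)) ->
  forall (U : opens X) (x : L U), d U x = d' U x.
Proof.
move=> [_ [d'r d'D _ d'_deg _] d'br] d'1.
have d'0 (U : opens X) (a : A U) : d' U (ext0 L U a) = 0.
  by apply: (deg_gt0 hL (d'_deg _ _ _ (pv_deg0 hL a))).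
have d'M (U : opens X) (a c : L U) i j : deg i a -> deg j c ->
    d' U (a * c) = d' U a * c + sgn i * (a * d' U c) + sgn i * br a c.
  move=> da dc; rewrite (d'br _ _ _ _ _ da dc).
  by rewrite [RHS]addrC (addrC (d' U a * c)) addrA !subrK.
apply: (homogeneous_ind hL (P := fun U x => d U x = d' U x)).
- move=> U x H; apply: ringSheaf_sep => p /H[V [h [Vp HV]]].
  by exists V, h; split=> //; rewrite -dr -d'r.
- by move=> U x y Hx Hy; rewrite raddfD d'D Hx Hy.
move=> n U x dx; apply: ringSheaf_sep => p Up.
have [V [h [Vp [j mj _]]]] := deg_loc_mono hL dx Up.
exists V, h; split=> //; rewrite -dr -d'r; move: (rres h x) mj => {x dx} x.
elim=> {j x} [j||j y z _ Hy _ Hz|j a y my Hy|j z y my Hy].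
- have := d'D V 0 0; rewrite addr0 raddf0 => /eqP.
  by rewrite -subr_eq0 opprD addNKr oppr_eq0 => /eqP ->.
- by rewrite -(rmorph1 (ext0 L V)) d0 d'0.
- by rewrite raddfD d'D Hy Hz.
- rewrite bv_mul0 (d'M _ _ _ _ _ (pv_deg0 hL a) (deg_mono hL my)) d'0 -Hy.
  by rewrite sgnE !mul1r mul0r add0r.
- rewrite bv_mul1 (d'M _ _ _ _ _ (pv_deg1 hL z) (deg_mono hL my)) d'1 -Hy.
  by rewrite sgnE !mulN1r.
Qed.

End Differential.

(** * Existence and uniqueness of the BV differential *)

Theorem theorem4p9 (k : fieldType) (char0 : [pchar k] =i pred0)
    (X : scheme k) (smX : smooth X) (A : DX_algebra X)
    (T : tangent_algebroid A) (L : exterior_algebra T)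
    (deg : int -> forall U : opens X, L U -> Prop)
    (br : forall U : opens X, L U -> L U -> L U)
    (hL : polyvector_gerstenhaber deg br)
    (D : DA_sheaf A) (C : CY_structure D)
    (nabla : forall U : opens X, {additive T U -> A U})
    (hnabla : associated_map C nabla) :
  exists! d : forall U : opens X, L U -> L U,
    batalin_vilkovisky (ext_kst L) deg br d /\
    forall (U : opens X) (x : T U), d U (ext1 L U x) = ext0 L U (nabla U x).
Proof.
have [sg [sgr sgd]] := exterior_parity hL.
have nr := nabla_res hnabla; have nZ := nablaZ hnabla.
have nf := nabla_flat hnabla.
have [d [dr d0 d1 dM]] := bv_operator_exists char0 hL sgr sgd nr nZ.
exists (fun U => d U); split.
  by split=> //; exact: (bv_structure hL sgr sgd nr nf dr d0 d1 dM).
move=> d' [d'bv d'1]; apply: functional_extensionality_dep => U.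
apply: funext => x.
exact: (bv_unique hL sgd dr d0 d1 dM d'bv d'1).
Qed.
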